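(* Suppose $y_0:\mathbb{R}\to[0,\infty)$ is a locally Lipschitz function with $A_0:=\|y_0\|_{L^1(\mathbb{R})}\in(0,\infty)$, and let $y:\mathbb{R}\times[0,\infty)\to\mathbb{R}$ be the unique Ecker-Huisken solution of $y_t=\frac{y_{xx}}{1+y_x^2}$ starting with $y_0$. Then for all $t>\tau:=\frac{A_0}{\pi}$ we have $$y(x,t)\leq t^{1/2}\,W\left[\sigma^{-1}\left(\frac{A_0}{2t}\right)\right]$$ for all $x\in\mathbb{R}$.
   Context: Graphical curve shortening flow is the equation $y_t=\frac{y_{xx}}{1+y_x^2}=(\arctan y_x)_x$. For every locally Lipschitz $y_0:\mathbb{R}\to\mathbb{R}$ there is (Ecker-Huisken existence, Chou-Zhu uniqueness) a unique continuous function $y:\mathbb{R}\times[0,\infty)\to\mathbb{R}$ that is smooth and solves this equation on $\mathbb{R}\times(0,\infty)$, with $y(\cdot,0)=y_0$ and $y(\cdot,t)\to y_0$ locally uniformly as $t\downarrow 0$. It is called the Ecker-Huisken solution starting with $y_0$. Definition of $W$: let $u$ be the Ecker-Huisken solution starting with $u_0(x)=|x|$. The image of the graph of $u(\cdot,1)$ under clockwise rotation by $\frac{\pi}{4}$ about the origin is the graph of a function $W:(0,\infty)\to(0,\infty)$; equivalently, $W$ is the time-$1$ slice of the self-similar curve shortening flow starting from the union of the non-negative $x$-axis and the positive $y$-axis. $W$ is a decreasing convex diffeomorphism of $(0,\infty)$ with $W^{-1}=W$ and $\int_0^\infty W=\frac{\pi}{2}$, and $\mathcal{W}(x,t):=t^{1/2}W(xt^{-1/2})$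 solves $y_t=\frac{y_{xx}}{1+y_x^2}$. Define $\sigma:(0,\infty)\to(0,\frac{\pi}{2})$ by $\sigma(x):=\int_x^\infty W(s)\,ds$, a decreasing bijection. *)

(* Defs.v *)
From HB Require Import structures.
From mathcomp Require Import all_boot all_order all_algebra.
From mathcomp Require Import all_classical all_reals all_analysis.

Set Implicit Arguments.
Unset Strict Implicit.
Unset Printing Implicit Defensive.

Import Order.TTheory GRing.Theory Num.Theory.
Import numFieldNormedType.Exports.

Local Open Scope classical_set_scope.
Local Open Scope ring_scope.

(* Functions of (x, t) are functions on [R * R]; their values at [t < 0] are
   junk that no definition below looks at. *)

Definition dx {R : realType} (f : R * R -> R) : R * R -> R := 'D_(1, 0) f.
Definition dt {R : realType} (f : R * R -> R) : R * R -> R := 'D_(0, 1) f.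

(* The derivatives are total functions, so their existence on [D] is required
   separately. [D] is meant to be open. *)
Fixpoint Ck {R : realType} (k : nat) (D : set (R * R)) (f : R * R -> R) : Prop :=
  (forall p, D p -> {for p, continuous f}) /\
  match k with
  | 0 => True
  | k'.+1 =>
      (forall p, D p -> derivable f p (1, 0) /\ derivable f p (0, 1)) /\
      Ck k' D (dx f) /\ Ck k' D (dt f)
  end.

Definition smooth {R : realType} (D : set (R * R)) (f : R * R -> R) : Prop :=
  forall k, Ck k D f.

(* On the locally compact space [R], locally uniform convergence is uniform
   convergence on compact sets. *)
Record EckerHuisken {R : realType} (y0 : R -> R) (y : R * R -> R) : Prop := {
  EH_continuous : {within [set p | 0 <= p.2], continuous y};
  EH_smooth : smooth [set p | 0 < p.2] y;
  EH_equation : forall p, 0 < p.2 ->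
    dt y p = dx (dx y) p / (1 + (dx y p) ^+ 2);
  EH_initial : forall x, y (x, 0) = y0 x;
  EH_cvg : {family compact, (fun t x => y (x, t)) @ 0^'+ --> y0} }.

Definition graph_on {R : realType} (D : set R) (f : R -> R) : set (R * R) :=
  [set (x, f x) | x in D].

Definition clockwise {R : realType} (a : R) (p : R * R) : R * R :=
  (p.1 * cos a + p.2 * sin a, p.2 * cos a - p.1 * sin a).

(* [W] represents a function (0, oo) -> (0, oo); only its values on (0, oo)
   are constrained. *)
Definition is_W {R : realType} (W : R -> R) : Prop :=
  exists u : R * R -> R,
    [/\ EckerHuisken (fun x => `|x|) u,
        forall x, 0 < x -> 0 < W x
      & clockwise (pi / 4) @` graph_on setT (fun x => u (x, 1)) =
        graph_on [set x | 0 < x] W].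

Definition sigma {R : realType} (W : R -> R) (x : R) : R :=
  (\int[lebesgue_measure]_(s in `]x, +oo[) W s)%R.

(* Outside of the image of (0, oo) by [sigma W], this is the junk value 1. *)
Definition sigma_inv {R : realType} (W : R -> R) : R -> R :=
  'pinv_(fun=> 1) [set x | 0 < x] (sigma W).

(* Main.v *)
(* Write the flow as y = H_x for a potential H with H_t = arctan H_xx. Since H_t
   is bounded, two potentials differ by a function that stays within a linear
   function of t of its initial value, so the maximum principle applies on the
   whole line without any growth condition. It gives uniqueness for potentials,
   and shows that H remains between the bounds of its initial value.

   Uniqueness makes the solution u starting from |x| even and self-similar, so
   that arctan U' = k - x U / 2 for U = u(., 1) and its potential k. With S z the
   area under W to the right of z, this equation becomes, after the rotation,
   arctan (- W') = S + z W / 2, which says that t S (x / sqrt t) is a potential.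

   Let P be the area under y(., t) to the right of a point. By a Sturmian argument
   P - t S ((x - c) / sqrt t) can only change sign from negative to positive, for
   every c, because the initial data of the second term is an infinitely high wall
   at c. Hence P <= t S a forces y <= sqrt t * W a. At every point the area to the
   right or the area to the left is at most A0 / 2, which is the case t S a = A0 / 2
   of this bound. *)
Require Import Defs.
From HB Require Import structures.
From mathcomp Require Import all_boot all_order all_algebra.
From mathcomp Require Import all_classical all_reals all_analysis.
From mathcomp Require Import ring lra.
Import Order.TTheory GRing.Theory Num.Theory.
Import numFieldNormedType.Exports.
Local Open Scope classical_set_scope.
Local Open Scope ring_scope.

(** * Derivative tests *)

Section Calculus.
Set Implicit Arguments.
Unset Strict Implicit.
Context {R : realType}.
Implicit Types (f g : R -> R) (a b l r x y : R).

Lemma is_derive_increasing_at f x l : is_derive x 1 f l -> 0 < l ->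
  exists2 r, 0 < r & forall h, 0 < h < r -> f (x - h) < f x < f (x + h).
Proof.
move=> [dfx dfE] l0.
have : (fun h : R => h^-1 *: (f (h *: 1 + x) - f x)) @ 0^' --> l.
  by rewrite -dfE; exact: dfx.
move=> /cvgrPdist_lt/(_ l l0)[r /= r0 rP]; exists r => // h /andP[h0 hr].
have P (k : R) : `|k| < r -> k != 0 -> 0 < k^-1 * (f (k + x) - f x).
  move=> kr k0; have := rP k; rewrite /= sub0r normrN => /(_ kr k0).
  rewrite scaler1 ltr_distlC => /andP[+ _].
  by rewrite subrr.
have := P h; rewrite gtr0_norm// gt_eqF// => /(_ hr isT).
rewrite pmulr_rgt0 ?invr_gt0// subr_gt0 addrC => ->.
have := P (- h); rewrite normrN gtr0_norm// oppr_eq0 gt_eqF// => /(_ hr isT).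
by rewrite nmulr_rgt0 ?invr_lt0 ?oppr_lt0// subr_lt0 addrC => ->.
Qed.

(** One-sided, because in time a maximum may sit at the final time, where only earlier times can be
    compared. *)
Lemma is_derive_left_max_ge0 f x l r : is_derive x 1 f l -> 0 < r ->
  (forall y, x - r < y <= x -> f y <= f x) -> 0 <= l.
Proof.
move=> fl r0 fx; rewrite leNgt; apply/negP => l0.
have [|s s0 sP] := @is_derive_increasing_at (- f) x (- l) _ _.
  by rewrite oppr_gt0.
have rs0 : 0 < Num.min r s by rewrite lt_min r0.
have : 0 < Num.min r s / 2 < s.
  rewrite divr_gt0// ltr_pdivrMr//.
  by move: (ge_min s r s); rewrite lexx orbT => ms; nra.
move=> /sP/andP[+ _]; rewrite opprfctE ltrN2 ltNge fx//.
by move: (ge_min r r s); rewrite lexx/= => mr; nra.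
Qed.

Lemma mvt f df a b : a < b -> (forall x, a <= x <= b -> is_derive x 1 f (df x)) ->
  exists2 c, a < c < b & f b - f a = df c * (b - a).
Proof.
move=> ab fdf.
have [x xab||c cab E] := @MVT _ f df a b ab _ _.
- by apply: fdf; move: xab; rewrite in_itv/= => /andP[/ltW-> /ltW->].
- apply: derivable_within_continuous => x; rewrite in_itv/= => /fdf.
  by case.
- by exists c; rewrite // -in_itv.
Qed.

Lemma is_derive_local_max f x l r : is_derive x 1 f l -> 0 < r ->
  (forall y, `|y - x| < r -> f y <= f x) -> l = 0.
Proof.
move=> fl r0 fx; apply/eqP; rewrite eq_le; apply/andP; split; last first.
  apply: (@is_derive_left_max_ge0 f x l r) => // y /andP[ry yx].
  have [->//|yx'] := eqVneq y x.
  by apply: fx; rewrite distrC ger0_norm; lra.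
rewrite leNgt; apply/negP => l0.
have [s s0 sP] := is_derive_increasing_at fl l0.
have rs0 : 0 < Num.min r s by rewrite lt_min r0.
have : 0 < Num.min r s / 2 < s.
  rewrite divr_gt0// ltr_pdivrMr//.
  by move: (ge_min s r s); rewrite lexx orbT => ms; nra.
move=> /sP/andP[_]; rewrite ltNge fx//.
rewrite addrAC subrr add0r ger0_norm ?divr_ge0 ?(ltW rs0)//.
by move: (ge_min r r s); rewrite lexx/= => mr; nra.
Qed.

(** The first derivative vanishes at [x]; were its own derivative positive, [f1] would be positive
    just to the right of [x], and [f] would increase there by the mean value theorem. *)
Lemma second_derive_local_max f f1 x l r : 0 < r ->
  (forall y, `|y - x| < r -> is_derive y 1 f (f1 y)) -> is_derive x 1 f1 l ->
  (forall y, `|y - x| < r -> f y <= f x) -> l <= 0.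
Proof.
move=> r0 ff1 f1l fx; rewrite leNgt; apply/negP => l0.
have f1x : f1 x = 0.
  by apply: (is_derive_local_max (ff1 x _) r0 fx); rewrite subrr normr0.
have [s s0 sP] := is_derive_increasing_at f1l l0.
pose h := Num.min r s / 2.
have rs0 : 0 < Num.min r s by rewrite lt_min r0.
have [mr ms] : Num.min r s <= r /\ Num.min r s <= s.
  by rewrite !ge_min !lexx orbT.
have h0 : 0 < h by rewrite divr_gt0.
have hr : h < r by rewrite /h; lra.
have hs : h < s by rewrite /h; lra.
have [||c /andP[xc ch] E] := @mvt f f1 x (x + h).
- by rewrite ltrDl.
- by move=> y /andP[xy yh]; apply: ff1; rewrite ger0_norm; lra.
have /andP[_] : f1 (x - (c - x)) < f1 x < f1 (x + (c - x)).
  by apply: sP; apply/andP; split; lra.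
rewrite f1x addrC subrK => f1c.
have : f (x + h) <= f x by apply: fx; rewrite addrAC subrr add0r gtr0_norm.
have : 0 < f1 c * (x + h - x) by apply: mulr_gt0; lra.
by rewrite -E; lra.
Qed.
End Calculus.

(** * The maximum principle *)

Section MaximumPrinciple.
Set Implicit Arguments.
Unset Strict Implicit.
Context {R : realType}.
Implicit Types x t : R.

(* The barrier is [eta * t + eta / 4 * x ^ 2], whose time derivative exceeds its
   second space derivative. *)
Lemma parabolic_maximum_principle (V Vx Vxx Vt : R -> R -> R) (C : R) :
  (forall x t, 0 < t -> is_derive x 1 (V ^~ t) (Vx x t)) ->
  (forall x t, 0 < t -> is_derive x 1 (Vx ^~ t) (Vxx x t)) ->
  (forall x t, 0 < t -> is_derive t 1 (V x) (Vt x t)) ->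
  (forall x t k, 0 < t -> 0 <= k -> Vxx x t <= k -> Vt x t <= k) ->
  (forall p : R * R, 0 < p.2 -> {for p, continuous (fun q => V q.1 q.2)}) ->
  (forall x t, 0 < t -> V x t <= C * t) ->
  forall x t, 0 < t -> V x t <= 0.
Proof.
move=> dV dVx dVt VxxVt cV VC x0 T T0; rewrite leNgt; apply/negP.
set m := V x0 T => m0.
pose M := `|C| + 1.
have M0 : 0 < M by rewrite /M ltr_wpDl.
have VM x t : 0 < t -> V x t <= M * t.
  move=> t0; apply: (le_trans (VC x t t0)); rewrite ler_wpM2r ?ltW//.
  by rewrite /M; have := ler_norm C; lra.
(* With this [eta] the barrier takes at most half of the value [m] at (x0, T), so [Z] has a maximum
   of at least m / 2. *)
pose eta := m / (2 * (1 + T + x0 ^+ 2)).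
have x00 : 0 <= x0 ^+ 2 by rewrite sqr_ge0.
have eta0 : 0 < eta by rewrite divr_gt0//; nra.
have etaE : eta * (1 + T + x0 ^+ 2) = m / 2.
  by rewrite /eta; field; lra.
(* At time [t1] the linear bound keeps [V] below m / 2, so the maximum is not on the bottom side. *)
pose t1 := Num.min T (m / (2 * M)) / 2.
have mM : 0 < m / (2 * M) by rewrite divr_gt0//; lra.
have mn0 : 0 < Num.min T (m / (2 * M)) by rewrite lt_min T0.
have t10 : 0 < t1 by rewrite /t1; lra.
have t1T : t1 < T.
  have : Num.min T (m / (2 * M)) <= T by rewrite ge_min lexx.
  by rewrite /t1; lra.
have t1M : M * t1 < m / 2.
  have : Num.min T (m / (2 * M)) <= m / (2 * M) by rewrite ge_min lexx orbT.
  move=> h; have -> : m / 2 = M * (m / (2 * M)) by field; lra.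
  by rewrite ltr_pM2l// /t1; lra.
(* At |x| = L the term eta / 4 * x ^ 2 is at least M * T, so the maximum is not on the lateral
   sides. *)
pose L := `|x0| + 1 + 4 * M * T / eta.
have MT : 0 < 4 * M * T / eta by rewrite divr_gt0//; nra.
have x0n := normr_ge0 x0.
have L1 : 1 <= L by rewrite /L; lra.
pose Z (p : R * R) := V p.1 p.2 - eta * p.2 - eta / 4 * (p.1 * p.1).
pose A := `[- L, L] `*` `[t1, T].
have A0 : A (x0, T).
  split; rewrite /= in_itv/=; last by rewrite lexx ltW.
  by rewrite -ler_norml /L; lra.
have cA : compact A by apply: compact_setX; exact: segment_compact.
have cZ : {within A, continuous Z}.
  apply: continuous_in_subspaceT => p; rewrite inE => -[_ /=].
  rewrite in_itv/= => /andP[p1 _].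
  apply: cvgB; last first.
    by apply: cvgMr; apply: cvgM; exact: cvg_fst.
  apply: cvgB; last by apply: cvgMr; exact: cvg_snd.
  by apply: cV; exact: lt_le_trans p1.
have [[x t]] := @compact_EVT_max _ _ Z A (ex_intro _ _ A0) cA cZ.
rewrite inE => -[/=]; rewrite !in_itv/= -ler_norml => xL /andP[t1t tT] Zmax.
have t0 : 0 < t by exact: lt_le_trans t1t.
have Z0 : m / 2 <= Z (x0, T).
  by rewrite /Z/= -/m -etaE; nra.
have Zm := le_trans Z0 (Zmax _ (mem_set A0)).
have x2 : 0 <= x ^+ 2 by rewrite sqr_ge0.
have tt1 : t1 < t.
  rewrite lt_neqAle t1t andbT; apply/eqP => tE.
  have := VM x t t0; move: Zm; rewrite /Z/= -tE; nra.
have xL' : `|x| < L.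
  rewrite lt_neqAle xL andbT; apply/eqP => xE.
  have xE2 : x ^+ 2 = L ^+ 2 by rewrite -xE real_normK// num_real.
  have := VM x t t0; move: Zm; rewrite /Z/= -expr2 xE2.
  have : eta * L >= 4 * M * T.
    have -> : 4 * M * T = eta * (4 * M * T / eta) by field; lra.
    by rewrite ler_pM2l// /L; lra.
  have : M * t <= M * T by rewrite ler_pM2l.
  have : eta * L <= eta * L ^+ 2 by rewrite ler_pM2l// expr2 ler_peMl//; lra.
  have : 0 < eta * t by rewrite mulr_gt0.
  lra.
have Vxx_le : Vxx x t - eta / 2 <= 0.
  apply: (@second_derive_local_max R (fun y => Z (y, t))
    (fun y => Vx y t - eta / 2 * y) x _ (L - `|x|)).
  - by rewrite subr_gt0.
  - move=> y _; rewrite /Z/=.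
    have := dV y t t0 => ?.
    apply: is_derive_eq.
    by rewrite /GRing.scale/=; field.
  - have := dVx x t t0 => ?; apply: is_derive_eq.
    by rewrite /GRing.scale/=; field.
  - move=> y yx; apply: Zmax; rewrite inE; split; rewrite /= in_itv/= ?t1t//.
    by rewrite -ler_norml; have := ler_normD (y - x) x; rewrite subrK; lra.
have Vt_ge : 0 <= Vt x t - eta.
  apply: (@is_derive_left_max_ge0 R (fun s => Z (x, s)) t _ (t - t1)).
  - rewrite /Z/=; have := dVt x t t0 => ?; apply: is_derive_eq.
    by rewrite /GRing.scale/=; field.
  - by rewrite subr_gt0.
  - move=> s /andP[st ts]; apply: Zmax; rewrite inE; split; rewrite /= in_itv/=.
      by rewrite -ler_norml.
    by apply/andP; split; lra.
(* The maximum gives Vxx <= eta / 2 and Vt >= eta, which contradicts the hypothesis for k = eta /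
   2. *)
have := VxxVt x t (eta / 2) t0; lra.
Qed.
End MaximumPrinciple.

(** * Sturmian comparison *)

Section SturmComparison.
Set Implicit Arguments.
Unset Strict Implicit.
Context {R : realType}.

Lemma continuous_gt_left (f : R -> R) (t m : R) : {for t, continuous f} ->
  m < f t -> exists2 r, 0 < r & forall h, 0 <= h < r -> m < f (t - h).
Proof.
move=> cf /(cvgr_gt (f t) cf)/nbhs_ballP[r /= r0 rP]; exists r => // h /andP[h0 hr].
by apply: rP; rewrite /ball/= opprB addrC subrK ger0_norm.
Qed.

(* At a maximum of [min (D x1 t) (- D x2 t) - eta * (t - t1)] over x1 <= x2, both x1
   and x2 turn out to be spatial maxima of their terms, so that both terms were
   larger just before t. *)
Lemma sturm_two_point (D Dx Dxx Dt : R -> R -> R) (c e t1 T : R) : t1 < T ->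
  (forall x t, c < x -> t1 < t -> is_derive x 1 (D ^~ t) (Dx x t)) ->
  (forall x t, c < x -> t1 < t -> is_derive x 1 (Dx ^~ t) (Dxx x t)) ->
  (forall x t, c < x -> t1 < t -> is_derive t 1 (D x) (Dt x t)) ->
  (forall x t, c < x -> t1 < t -> Dxx x t <= 0 -> Dt x t <= 0) ->
  (forall x t, c < x -> t1 < t -> 0 <= Dxx x t -> 0 <= Dt x t) ->
  (forall p : R * R, c <= p.1 -> t1 <= p.2 ->
     {for p, continuous (fun q => D q.1 q.2)}) ->
  (forall x, c <= x -> 0 <= D x t1) ->
  (forall t, t1 <= t <= T -> 0 <= D e t) ->
  (forall t r, t1 < t <= T -> 0 < r -> exists2 x, c < x < c + r & D c t < D x t) ->
  forall x1 x2, c <= x1 -> x1 < x2 -> x2 <= e -> 0 < D x1 T -> 0 <= D x2 T.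
Proof.
move=> t1T dD dDx dDt Dt_le Dt_ge cD D1 De Dc X1 X2 cX1 X12 X2e D1T.
rewrite leNgt; apply/negP => D2T.
pose m0 : R := Num.min (D X1 T) (- D X2 T).
have m00 : 0 < m0 by rewrite lt_min D1T oppr_gt0.
(* The penalty reaches only m0 / 2 at time [T], so the maximum of [Z] below is positive. *)
pose eta : R := m0 / 2 / (T - t1).
have eta0 : 0 < eta by rewrite !divr_gt0// subr_gt0.
have etaT : eta * (T - t1) = m0 / 2 by rewrite divfK// gt_eqF// subr_gt0.
pose F x t : R := D x t - eta * (t - t1).
pose G x t : R := - D x t - eta * (t - t1).
pose A : set ((R * R) * R) := (`[c, e] `*` `[c, e]) `*` `[t1, T].
pose A' := A `&` [set p | 0 <= p.1.2 - p.1.1].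
pose Z (p : (R * R) * R) : R := Num.min (F p.1.1 p.2) (G p.1.2 p.2).
have cA' : compact A'.
  apply: compact_closedI.
    by apply: compact_setX; [apply: compact_setX|]; exact: segment_compact.
  apply: (@preimage_closed _ _ _ [set x : R | 0 <= x] _ (@closed_ge _ 0)) => p _.
  by apply: cvgB; apply: (cvg_comp fst); first [exact: cvg_fst|exact: cvg_snd].
have cZ : {within A', continuous Z}.
  apply: continuous_in_subspaceT => p; rewrite inE => -[[[/=]]].
  rewrite !in_itv/= => /andP[p11 _] /andP[p12 _] /andP[p2 _] _.
  have cl : (fun q : R * R * R => eta * (q.2 - t1)) @ p --> eta * (p.2 - t1).
    by apply: cvgMr; apply: cvgB; [exact: cvg_snd|exact: cvg_cst].
  apply: (@continuous_min _ _ (fun q => F q.1.1 q.2) (fun q => G q.1.2 q.2));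
    apply: cvgB => //.
    apply: (@continuous2_cvg _ _ _ _ _ _ (fun q => q.1.1) (fun q => q.2) D).
    - by apply: (cD (p.1.1, p.2)).
    - by apply: (cvg_comp fst fst); [exact: cvg_fst|exact: cvg_fst].
    - exact: cvg_snd.
  apply: cvgN.
  apply: (@continuous2_cvg _ _ _ _ _ _ (fun q => q.1.2) (fun q => q.2) D).
  - by apply: (cD (p.1.2, p.2)).
  - by apply: (cvg_comp fst snd); [exact: cvg_fst|exact: cvg_snd].
  - exact: cvg_snd.
have A0 : A' ((X1, X2), T).
  split; last by rewrite /= subr_ge0 ltW.
  by split; [split|]; rewrite /= in_itv/=; apply/andP; split; lra.
have [[[x1 x2] t]] := @compact_EVT_max _ _ Z A' (ex_intro _ _ A0) cA' cZ.
rewrite inE => -[[[/=]]]; rewrite !in_itv/= => /andP[cx1 x1e] /andP[cx2 x2e].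
move=> /andP[t1t tT]; rewrite subr_ge0 => x12 Zmax.
set m : R := Z (x1, x2, t) in Zmax.
have m_gt0 : 0 < m.
  apply: (lt_le_trans _ (Zmax _ (mem_set A0))).
  rewrite /Z/= /F /G etaT lt_min.
  have : m0 <= D X1 T /\ m0 <= - D X2 T by rewrite !ge_min !lexx orbT.
  by move=> [? ?]; apply/andP; split; lra.
have [mF mG] : m <= F x1 t /\ m <= G x2 t by rewrite !ge_min !lexx orbT.
have etat : 0 <= eta * (t - t1) by apply: mulr_ge0; lra.
have Dx1 : 0 < D x1 t by move: mF; rewrite /F; lra.
have Dx2 : D x2 t < 0 by move: mG; rewrite /G; lra.
(* The maximiser avoids these faces: [D] is non-negative at time [t1] and at [e], and [D x1 t],
   [D x2 t] have opposite signs. The face x1 = c is excluded in [Fdrop]. *)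
have {}t1t : t1 < t.
  rewrite lt_neqAle t1t andbT; apply/eqP => tE.
  by have := D1 _ cx2; rewrite tE; lra.
have {}x2e : x2 < e.
  rewrite lt_neqAle x2e andbT; apply/eqP => xE.
  by have := De t; rewrite -xE tT ltW// => /(_ isT); lra.
have {}x12 : x1 < x2.
  by rewrite lt_neqAle x12 andbT; apply/eqP => xE; move: Dx1; rewrite xE; lra.
have {}cx2 : c < x2 by exact: le_lt_trans x12.
pose r : R := Num.min ((x2 - x1) / 2) (Num.min (e - x2) (t - t1)).
have [r1 r2 r3] : [/\ r <= (x2 - x1) / 2, r <= e - x2 & r <= t - t1].
  by split; rewrite !ge_min ?lexx ?orbT.
have r0 : 0 < r by rewrite !lt_min; apply/and3P; split; lra.
(* Maximality of [Z]: near the maximiser and not after [t], the two terms never exceed [m]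
   together. *)
have key y1 y2 h : c <= y1 -> `|y1 - x1| < r -> `|y2 - x2| < r -> 0 <= h < r ->
    m < F y1 (t - h) -> G y2 (t - h) <= m.
  move=> cy1; rewrite !ltr_distl => /andP[? ?] /andP[? ?] /andP[? ?] mF1.
  have : Z (y1, y2, t - h) <= m.
    apply: Zmax; rewrite inE; split; last by rewrite /=; lra.
    by split; [split|]; rewrite /= in_itv/=; apply/andP; split; lra.
  by rewrite /Z/= ge_min leNgt mF1.
have xx1 : `|x1 - x1| < r by rewrite subrr normr0.
have xx2 : `|x2 - x2| < r by rewrite subrr normr0.
(* If x2 is a spatial maximum of [G], then Dxx >= 0 and hence Dt >= 0 there, so [G] decreases in
   time at rate at least [eta] and exceeded [m] just before [t]. *)
have Gdrop : (forall y, `|y - x2| < r -> G y t <= m) ->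
    exists2 s, 0 < s & forall h, 0 < h < s -> m < G x2 (t - h).
  move=> Gm; have Dxx2 : 0 <= Dxx x2 t.
    rewrite -oppr_le0.
    apply: (@second_derive_local_max _ (fun y => - D y t) (fun y => - Dx y t) x2 _
      (Num.min r (x2 - c))).
    - by rewrite lt_min r0 subr_gt0.
    - move=> y; rewrite lt_min => /andP[_]; rewrite ltr_distl => /andP[cy _].
      by apply: is_deriveN; apply: dD => //; lra.
    - by apply: is_deriveN; exact: dDx.
    - move=> y; rewrite lt_min => /andP[yr _].
      by have := Gm y yr; move: mG; rewrite /G; lra.
  have Dt2 := Dt_ge x2 t cx2 t1t Dxx2.
  have [||s s0 sP] := @is_derive_increasing_at _ (fun s => - G x2 s) t (Dt x2 t + eta).
  - have := dDt x2 t cx2 t1t => ?; rewrite /G; apply: is_derive_eq.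
    by rewrite /GRing.scale/=; lra.
  - lra.
  exists s => // h hs; have /andP[+ _] := sP h hs.
  by have := mG; lra.
(* The same for [F]. A spatial maximum at x1 = c is impossible, since [D] takes larger values
   immediately to the right of [c]. *)
have Fdrop : (forall y, c <= y -> `|y - x1| < r -> F y t <= m) ->
    exists2 s, 0 < s & forall h, 0 < h < s -> m < F x1 (t - h).
  move=> Fm; have {}cx1 : c < x1.
    rewrite lt_neqAle cx1 andbT; apply/eqP => cE.
    have [|x /andP[cx xr]] := Dc t r _ r0; first by apply/andP; split.
    have := Fm x (ltW cx); rewrite -cE => /(_ _)/[swap]; rewrite cE.
    have -> : `|x - x1| < r by rewrite gtr0_norm; lra.
    by move=> + /(_ isT); move: mF; rewrite /F; lra.
  have Dxx1 : Dxx x1 t <= 0.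
    apply: (@second_derive_local_max _ (fun y => D y t) (fun y => Dx y t) x1 _
      (Num.min r (x1 - c))).
    - by rewrite lt_min r0 subr_gt0.
    - move=> y; rewrite lt_min => /andP[_]; rewrite ltr_distl => /andP[cy _].
      by apply: dD => //; lra.
    - exact: dDx.
    - move=> y; rewrite lt_min => /andP[yr]; rewrite ltr_distl => /andP[cy _].
      by have := Fm y _ yr; move: mF; rewrite /F; lra.
  have Dt1 := Dt_le x1 t cx1 t1t Dxx1.
  have [||s s0 sP] := @is_derive_increasing_at _ (fun s => - F x1 s) t (eta - Dt x1 t).
  - have := dDt x1 t cx1 t1t => ?; rewrite /F; apply: is_derive_eq.
    by rewrite /GRing.scale/=; lra.
  - lra.
  exists s => // h hs; have /andP[+ _] := sP h hs.
  by have := mF; lra.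
have cFG y : c <= y -> {for t, continuous (F y)} /\ {for t, continuous (G y)}.
  move=> cy; have cDy : {for t, continuous (D y)}.
    have := cD (y, t) cy (ltW t1t).
    move=> /(@continuous2_cvg _ _ _ _ (nbhs t) _ (fun=> y) id); apply => //.
    exact: cvg_cst.
  have cl : (fun q : R => eta * (q - t1)) @ t --> eta * (t - t1).
    by apply: cvgMr; apply: cvgB; [exact: cvg_id|exact: cvg_cst].
  by split; apply: cvgB => //; exact: cvgN.
pose mn3 (a b d : R) : R := Num.min a (Num.min b d) / 2.
have mn3P a b d : 0 < a -> 0 < b -> 0 < d ->
    [/\ 0 < mn3 a b d < a, 0 < mn3 a b d < b & 0 < mn3 a b d < d].
  move=> a0 b0 d0; have ? : 0 < Num.min a (Num.min b d) by rewrite !lt_min a0 b0.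
  have [? ? ?] : [/\ Num.min a (Num.min b d) <= a, Num.min a (Num.min b d) <= b &
    Num.min a (Num.min b d) <= d] by rewrite !ge_min !lexx !orbT.
  by split; apply/andP; rewrite /mn3; split; lra.
have lt2le (h s : R) : 0 < h < s -> 0 <= h < s by move=> /andP[/ltW-> ->].
(* A maximum of a minimum need not maximise either term. If [F] exceeds [m] at some y1 near x1, then
   [key] with h = 0 bounds [G] by [m] near x2; [Gdrop] and continuity of [F] in time then make both
   terms exceed [m] just before [t]. Otherwise [Fdrop] applies, and the same alternative is run for
   [G]. *)
have [[y1 [cy1 y1x1 Fy1]]|nF] :=
    pselect (exists y1, [/\ c <= y1, `|y1 - x1| < r & m < F y1 t]).
  have [|s s0 sP] := Gdrop.
    move=> y2 y2x2; have := key y1 y2 0; rewrite subr0; apply=> //.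
    by rewrite lexx.
  have [s' s'0 s'P] := continuous_gt_left (cFG _ cy1).1 Fy1.
  have [/lt2le h1 h2 /lt2le h3] := mn3P _ _ _ r0 s0 s'0.
  have := key _ x2 _ cy1 y1x1 xx2 h1 (s'P _ h3).
  by rewrite leNgt sP.
have [|s s0 sP] := Fdrop.
  move=> y cy yx; rewrite leNgt; apply/negP => mFy.
  by apply: nF; exists y.
have [|s' s'0 s'P] := Gdrop.
  move=> y yx; rewrite leNgt; apply/negP => mGy.
  have cy : c <= y by move: yx; rewrite ltr_distl => /andP[? _]; lra.
  have [s' s'0 s'P] := continuous_gt_left (cFG _ cy).2 mGy.
  have [/lt2le h1 h2 /lt2le h3] := mn3P _ _ _ r0 s0 s'0.
  have := key x1 y _ cx1 xx1 yx h1 (sP _ h2).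
  by rewrite leNgt s'P.
have [/lt2le h1 h2 h3] := mn3P _ _ _ r0 s0 s'0.
have := key x1 x2 _ cx1 xx1 xx2 h1 (sP _ h2).
by rewrite leNgt s'P.
Qed.
End SturmComparison.

(** * Potentials *)

Section Potential.
Set Implicit Arguments.
Unset Strict Implicit.
Context {R : realType}.
Implicit Types (H K : R -> R -> R) (x s t c : R).

Lemma is_derive_comp (f g : R -> R) (x a b l : R) :
  is_derive (g x) 1 f a -> is_derive x 1 g b -> a * b = l ->
  is_derive x 1 (fun y => f (g y)) l.
Proof. by move=> fa gb <-; exact: is_derive1_comp. Qed.

Lemma is_derive_continuous (f : R -> R) (x l : R) :
  is_derive x 1 f l -> {for x, continuous f}.
Proof. by case=> fx _; apply/differentiable_continuous/derivable1_diffP. Qed.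

(** The derivative of [atan] lies between 0 and 1. This is the form in which differences of
    potentials meet the hypothesis of [parabolic_maximum_principle]. *)
Lemma ler_atanB (a b k : R) : 0 <= k -> a - b <= k -> atan a - atan b <= k.
Proof.
move=> k0 abk; have [ab|ba] := leP a b.
  by have := le_atan ab; lra.
have [c _ ->] := @mvt _ atan (fun x => (1 + x ^+ 2)^-1) b a ba
  (fun x _ => is_derive1_atan x).
have c2 : 0 <= c ^+ 2 by rewrite sqr_ge0.
have : (1 + c ^+ 2)^-1 <= 1 by rewrite invf_le1 ?ler_wpDr//; lra.
have : 0 <= (1 + c ^+ 2)^-1 by rewrite invr_ge0; lra.
nra.
Qed.

(** The integrated flow: [Hx] is the height of the curve. Initial values are kept apart and enter
    through bounds linear in [t]. *)
Definition potential (H Hx Hxx : R -> R -> R) := forall x t : R, 0 < t ->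
  [/\ is_derive x 1 (H ^~ t) (Hx x t), is_derive x 1 (Hx ^~ t) (Hxx x t)
    & is_derive t 1 (H x) (atan (Hxx x t))].

(** The time derivative is an arctangent, so its absolute value is below pi / 2. *)
Lemma potential_lipschitz H Hx Hxx x s t : potential H Hx Hxx ->
  0 < s -> 0 < t -> `|H x t - H x s| <= pi / 2 * `|t - s|.
Proof.
move=> pH; wlog st : s t / s < t => [hw s0 t0|s0 _].
  have [st|ts|->] := ltgtP s t; first exact: hw.
    by rewrite distrC (distrC t); exact: hw.
  by rewrite !subrr normr0 mulr0.
have [|c _ ->] := @mvt _ (H x) (fun t => atan (Hxx x t)) s t st.
  by move=> r /andP[sr _]; have [] := pH x r (lt_le_trans s0 sr).
rewrite normrM ler_wpM2r// ler_norml.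
by rewrite !ltW ?atan_ltpi2// -?mulNr ?mulNr ?atan_gtNpi2.
Qed.

(** Continuity in [x] at a fixed time combines with a Lipschitz bound in time that is uniform in
    [x]. *)
Lemma potential_continuous H Hx Hxx : potential H Hx Hxx ->
  forall p : R * R, 0 < p.2 -> {for p, continuous (fun q => H q.1 q.2)}.
Proof.
move=> pH [x t] /= t0.
have [/is_derive_continuous cH _ _] := pH x t t0.
have pi0 := @pi_gt0 R.
apply/cvgrPdist_lt => /= e e0.
have e2 : 0 < e / 2 by lra.
have : \forall q \near (x, t), 0 < q.2 /\ `|t - q.2| < e / 2 / pi.
  apply: (@cvg_snd _ _ (nbhs x) (nbhs t) _ [set s | 0 < s /\ `|t - s| < e / 2 / pi]).
  apply: filterI; first exact: lt_nbhsr.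
  have: id @ t --> t by exact: cvg_id.
  by move/cvgrPdist_lt; apply; rewrite divr_gt0.
have : \forall q \near (x, t), `|H x t - H q.1 t| < e / 2.
  apply: (@cvg_fst _ _ (nbhs x) (nbhs t) _ [set y | `|H x t - H y t| < e / 2]).
  by move/cvgrPdist_lt: cH; apply.
apply: filterS2 => -[y s] /= Hy [s0 ts].
have := potential_lipschitz y pH s0 t0.
have : pi * `|t - s| < e / 2 by rewrite mulrC -ltr_pdivlMr.
have -> : H x t - H y s = (H x t - H y t) + (H y t - H y s) by ring.
by have := ler_normD (H x t - H y t) (H y t - H y s); have := normr_ge0 (t - s); lra.
Qed.

(** Constants are potentials because atan 0 = 0, and the maximum principle applies to H - c. The
    term C * t lets the bound be checked against initial values only. *)
Lemma potential_le H Hx Hxx C c : potential H Hx Hxx ->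
  (forall x t, 0 < t -> H x t <= c + C * t) ->
  forall x t, 0 < t -> H x t <= c.
Proof.
move=> pH HC x t t0; rewrite -subr_le0.
apply: (@parabolic_maximum_principle _ (fun x t => H x t - c) Hx Hxx
  (fun x t => atan (Hxx x t)) C _ _ _ _ _ _ x t t0) => {x t t0}.
- by move=> x t t0; have [? _ _] := pH x t t0; apply: is_derive_eq; rewrite subr0.
- by move=> x t t0; have [] := pH x t t0.
- by move=> x t t0; have [_ _ ?] := pH x t t0; apply: is_derive_eq; rewrite subr0.
- move=> x t k t0 k0 Hk; have := @ler_atanB (Hxx x t) 0 k k0.
  by rewrite atan0 !subr0; apply.
- move=> p p0; apply: cvgB; last exact: cvg_cst.
  exact: (potential_continuous pH).
- by move=> x t t0; have := HC x t t0; lra.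
Qed.

Lemma potentialN H Hx Hxx : potential H Hx Hxx ->
  potential (fun x t => - H x t) (fun x t => - Hx x t) (fun x t => - Hxx x t).
Proof.
move=> pH x t t0; have [? ? ?] := pH x t t0; rewrite atanN.
by split; exact: is_deriveN.
Qed.

Lemma potential_reflect H Hx Hxx : potential H Hx Hxx ->
  potential (fun x t => H (- x) t) (fun x t => - Hx (- x) t)
    (fun x t => Hxx (- x) t).
Proof.
move=> pH x t t0; have [dH dHx ?] := pH (- x) t t0.
split=> //; first by apply: (is_derive_comp dH); rewrite mulrN1.
have ? : is_derive x 1 (fun y => Hx (- y) t) (- Hxx (- x) t).
  by apply: (is_derive_comp dHx); rewrite mulrN1.
by apply: is_derive_eq; rewrite opprK.
Qed.

Lemma potentialDl c H Hx Hxx : potential H Hx Hxx ->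
  potential (fun x t => c + H x t) Hx Hxx.
Proof.
move=> pH x t t0; have [? ? ?] := pH x t t0.
by split=> //; apply: is_derive_eq; rewrite add0r mul1r.
Qed.

(** Parabolic scaling: lengths are divided by [l], so the potential, which is an area, is divided by
    l ^ 2. *)
Lemma potential_scale (l : R) H Hx Hxx : 0 < l -> potential H Hx Hxx ->
  potential (fun x t => l ^- 2 * H (l * x) (l ^+ 2 * t))
    (fun x t => l^-1 * Hx (l * x) (l ^+ 2 * t))
    (fun x t => Hxx (l * x) (l ^+ 2 * t)).
Proof.
move=> l0 pH x t t0; have [|dH dHx dHt] := pH (l * x) (l ^+ 2 * t).
  by rewrite mulr_gt0// exprn_gt0.
have dl (y m : R) : is_derive y 1 (fun z : R => m * z) m.
  by apply: is_derive_eq; rewrite /GRing.scale/= mulr1.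
split.
- have ? := is_derive_comp dH (dl x l) erefl; apply: is_derive_eq.
  by rewrite /GRing.scale/=; field; rewrite gt_eqF.
- have ? := is_derive_comp dHx (dl x l) erefl; apply: is_derive_eq.
  by rewrite /GRing.scale/=; field; rewrite gt_eqF.
- have ? := is_derive_comp dHt (dl t (l ^+ 2)) erefl; apply: is_derive_eq.
  by rewrite /GRing.scale/=; field; rewrite gt_eqF.
Qed.

(** Both potentials stay within C * t of the same [h0], so their difference is at most 2 * C * t and
    the maximum principle applies to it in either order. *)
Lemma potential_unique H Hx Hxx K Kx Kxx h0 C :
  potential H Hx Hxx -> potential K Kx Kxx ->
  (forall x t, 0 < t -> `|H x t - h0 x| <= C * t) ->
  (forall x t, 0 < t -> `|K x t - h0 x| <= C * t) ->
  forall x t, 0 < t -> H x t = K x t.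
Proof.
wlog suff le_HK : H Hx Hxx K Kx Kxx / potential H Hx Hxx -> potential K Kx Kxx ->
    (forall x t, 0 < t -> `|H x t - h0 x| <= C * t) ->
    (forall x t, 0 < t -> `|K x t - h0 x| <= C * t) ->
    forall x t, 0 < t -> H x t <= K x t.
  move=> pH pK H0 K0 x t t0; apply/eqP; rewrite eq_le.
  by rewrite (le_HK H Hx Hxx K Kx Kxx)// (le_HK K Kx Kxx H Hx Hxx).
move=> pH pK H0 K0 x t t0; rewrite -subr_le0.
apply: (@parabolic_maximum_principle _ (fun x t => H x t - K x t)
  (fun x t => Hx x t - Kx x t) (fun x t => Hxx x t - Kxx x t)
  (fun x t => atan (Hxx x t) - atan (Kxx x t)) (2 * C) _ _ _ _ _ _ x t t0)
  => {x t t0}.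
- by move=> x t t0; have [? _ _] := pH x t t0; have [? _ _] := pK x t t0;
    exact: is_deriveB.
- by move=> x t t0; have [_ ? _] := pH x t t0; have [_ ? _] := pK x t t0;
    exact: is_deriveB.
- by move=> x t t0; have [_ _ ?] := pH x t t0; have [_ _ ?] := pK x t t0;
    exact: is_deriveB.
- by move=> x t k t0; exact: ler_atanB.
- by move=> p p0; apply: cvgB;
    [exact: (potential_continuous pH)|exact: (potential_continuous pK)].
- move=> x t t0; have := H0 x t t0; have := K0 x t t0.
  by rewrite !ler_norml => /andP[? ?] /andP[? ?]; lra.
Qed.
End Potential.

(** * The self-similar potential *)

Section Profile.
Set Implicit Arguments.
Unset Strict Implicit.
Context {R : realType}.

(* [W1] is the derivative of [W], and [S z] the area under [W] to the right of [z]. *)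
Record profile (W W1 S : R -> R) : Prop := {
  profileS : forall z : R, 0 < z -> is_derive z 1 S (- W z);
  profileW : forall z : R, 0 < z -> is_derive z 1 W (W1 z);
  profile_gt0 : forall z, 0 < z -> 0 < W z;
  profile_eq : forall z, 0 < z -> atan (- W1 z) = S z + z * W z / 2;
  profileS0 : S z @[z --> 0^'+] --> pi / 2;
  profileSy : S z @[z --> +oo] --> 0;
  profileW0 : W z @[z --> 0^'+] --> +oo }.

Variables (W W1 S : R -> R).
Hypothesis prof : profile W W1 S.

Lemma profile_decreasing (a b : R) : 0 < a -> a < b -> S b < S a.
Proof.
move=> a0 ab; rewrite -subr_lt0.
have [|c /andP[ac _] ->] := @mvt _ S (fun z => - W z) a b ab.
  by move=> x /andP[ax _]; apply: (profileS prof); exact: lt_le_trans ax.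
rewrite mulNr oppr_lt0 mulr_gt0 ?subr_gt0// (profile_gt0 prof)//.
exact: lt_trans ac.
Qed.

Lemma profile_lt_pihalf (a : R) : 0 < a -> S a < pi / 2.
Proof.
move=> a0; have a20 : 0 < a / 2 by lra.
(* The limit at 0 yields only a weak inequality; using it at a / 2 makes the one at [a] strict. *)
apply: (@lt_le_trans _ _ (S (a / 2))); first by apply: profile_decreasing; lra.
rewrite leNgt; apply/negP => Sa.
near (0:R)^'+ => z.
have z0 : 0 < z by near: z; exact: nbhs_right_gt.
have za : z < a / 2 by near: z; exact: nbhs_right_lt.
suff : S z < S (a / 2) by rewrite ltNge ltW// profile_decreasing.
near: z; exact: (cvgr_lt _ (profileS0 prof)).
Unshelve. all: by end_near. Qed.

(** Continuation of [S] by its limit at 0, so that the similarity solution is continuous up to the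
    wall. *)
Definition profile_ext (z : R) := if 0 < z then S z else pi / 2.

Lemma profile_ext_le z : profile_ext z <= pi / 2.
Proof. by rewrite /profile_ext; case: ifP => // z0; exact/ltW/profile_lt_pihalf. Qed.

Lemma profile_ext_continuous z : {for z, continuous profile_ext}.
Proof.
have [z0|z0|->] := ltgtP z 0.
- apply: (@near_cst_continuous _ _ (pi / 2)); near=> y.
  have y0 : y < 0 by near: y; exact: lt_nbhsl.
  by rewrite /profile_ext ltNge (ltW y0).
- apply: is_derive_continuous; apply: near_eq_is_derive (profileS prof z0).
  near=> y.
  have y0 : 0 < y by near: y; exact: lt_nbhsr.
  by rewrite /profile_ext y0.
- apply/cvgrPdist_lt => e e0; have /cvgrPdist_lt/(_ e e0) := profileS0 prof.
  move=> [r /= r0 rP]; exists r => // y /= yr.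
  rewrite /profile_ext ltxx; case: ifPn => y0; last by rewrite subrr normr0.
  exact: rP.
Unshelve. all: by end_near. Qed.

(** For x > c, the area to the right of [x] under the graph of sqrt t * W ((x - c) / sqrt t), the
    self-similar flow that starts from a wall at [c]. *)
Definition similarity_solution (c x t : R) := t * profile_ext ((x - c) / Num.sqrt t).

Lemma similarity_solution_continuous c (p : R * R) : 0 < p.2 ->
  {for p, continuous (fun q => similarity_solution c q.1 q.2)}.
Proof.
move=> p0; apply: cvgM; first exact: cvg_snd.
apply: (cvg_comp (fun q : R * R => (q.1 - c) / Num.sqrt q.2) profile_ext);
  last exact: profile_ext_continuous.
apply: cvgM; first by apply: cvgB; [exact: cvg_fst|exact: cvg_cst].
apply: cvgV; first by rewrite gt_eqF// sqrtr_gt0.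
by apply: (cvg_comp snd Num.sqrt); [exact: cvg_snd|exact: sqrt_continuous].
Qed.

(** To the right of the wall this is a potential: with z = (x - c) / sqrt t its time derivative is S
    z + z * W z / 2, an arctangent by [profile_eq]. *)
Lemma similarity_solution_derive (c x t : R) : c < x -> 0 < t ->
  [/\ is_derive x 1 (similarity_solution c ^~ t)
        (- (Num.sqrt t * W ((x - c) / Num.sqrt t))),
      is_derive x 1 (fun y => - (Num.sqrt t * W ((y - c) / Num.sqrt t)))
        (- W1 ((x - c) / Num.sqrt t))
    & is_derive t 1 (similarity_solution c x) (atan (- W1 ((x - c) / Num.sqrt t)))].
Proof.
move=> cx t0; set s := Num.sqrt t.
have s0 : 0 < s by rewrite sqrtr_gt0.
have ts : t = s ^+ 2 by rewrite sqr_sqrtr// ltW.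
set z := (x - c) / s.
have z0 : 0 < z by rewrite divr_gt0// subr_gt0.
have dz : is_derive x 1 (fun y => (y - c) / s) s^-1.
  by apply: is_derive_eq; rewrite /GRing.scale/= subr0 mulr0 add0r mulr1.
have dS := profileS prof z0.
have dE : is_derive z 1 profile_ext (- W z).
  apply: near_eq_is_derive dS; near=> y.
  have y0 : 0 < y by near: y; exact: lt_nbhsr.
  by rewrite /profile_ext y0.
split.
- have ? := @is_derive_comp _ profile_ext (fun y => (y - c) / s) x _ _ _ dE dz erefl.
  apply: is_derive_eq.
  by rewrite /GRing.scale/= ts; field; lra.
- have ? := @is_derive_comp _ W (fun y => (y - c) / s) x _ _ _ (profileW prof z0)
    dz erefl.
  apply: is_derive_eq.
  by rewrite /GRing.scale/=; field; lra.
- have ds := is_derive1_sqrt t0.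
  have dzt : is_derive t 1 (fun r => (x - c) / Num.sqrt r) (- (z / (2 * t))).
    have ? : is_derive t 1 (fun r => (Num.sqrt r)^-1) (- s ^- 2 *: (2 * s)^-1).
      by apply: is_deriveV; rewrite gt_eqF.
    by apply: is_derive_eq; rewrite /GRing.scale/= /z ts; field; lra.
  have ? := @is_derive_comp _ profile_ext (fun r => (x - c) / Num.sqrt r) t _ _ _
    dE dzt erefl.
  apply: is_derive_eq.
  rewrite /GRing.scale/= (profile_eq prof z0) /profile_ext -/s -/z z0.
  by rewrite ts; field; lra.
Unshelve. all: by end_near. Qed.

(* The slope of the similarity solution is infinite at [c], as [W] is at 0. *)
Lemma similarity_solution_left_edge (P : R -> R) (c l t r : R) :
  is_derive c 1 P l -> 0 < t -> 0 < r ->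
  exists2 x, c < x < c + r &
    P c - similarity_solution c c t < P x - similarity_solution c x t.
Proof.
move=> dP t0 r0; set s := Num.sqrt t.
have s0 : 0 < s by rewrite sqrtr_gt0.
have ts : t = s ^+ 2 by rewrite sqr_sqrtr// ltW.
pose K : R := `|l| + 1.
have [||k k0 kP] := @is_derive_increasing_at _ (fun x => P x + K * x) c (l + K).
- by apply: is_derive_eq; rewrite /GRing.scale/= mulr1.
- by rewrite /K; have := lerNnormlW (lexx `|l|); lra.
(* The factor 2 makes up for applying the mean value theorem only on the upper half of [0, h / s],
   away from the singular end. *)
have /cvgryPgt/(_ (2 * K / s))[d /= d0 dP'] := profileW0 prof.
pose m : R := Num.min r (Num.min k (d * s)).
have m0 : 0 < m by rewrite !lt_min r0 k0 mulr_gt0.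
have [mr mk md] : [/\ m <= r, m <= k & m <= d * s].
  by rewrite !ge_min !lexx !orbT.
pose h : R := m / 2.
exists (c + h); first by apply/andP; rewrite /h; split; lra.
have /kP/andP[_ Ph] : 0 < h < k by apply/andP; rewrite /h; split; lra.
have h0 : 0 < h by rewrite /h; lra.
rewrite /similarity_solution /profile_ext subrr mul0r ltxx.
have -> : c + h - c = h by ring.
have z0 : 0 < h / s by rewrite divr_gt0.
rewrite -/s z0.
have zd : h / s < d by rewrite ltr_pdivrMr// /h; lra.
have [||y /andP[y1 y2] Sy] := @mvt _ S (fun z => - W z) (h / s / 2) (h / s).
- lra.
- by move=> y /andP[y1 _]; apply: (profileS prof); lra.
have y0 : 0 < y by lra.
have Wy : 2 * K / s < W y.
  by apply: dP' => //=; rewrite sub0r normrN gtr0_norm//; lra.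
have S2 : S (h / s / 2) < pi / 2 by apply: profile_lt_pihalf; lra.
have KW : K * h < t * (W y * (h / s / 2)).
  have -> : K * h = t * (2 * K / s * (h / s / 2)) by rewrite ts; field; lra.
  by rewrite ltr_pM2l// ltr_pM2r//; lra.
have : t * S (h / s) < t * (pi / 2 - W y * (h / s / 2)).
  by rewrite ltr_pM2l//; move: Sy; lra.
rewrite mulrBr => tS.
have {}Ph : P c < P (c + h) + K * h by move: Ph; rewrite mulrDr; lra.
lra.
Qed.

(** Here [P] plays the area to the right and - Px the height. If the height were too large, a wall
    could be placed so that, at time [T], [P] raised by some delta > 0 meets the similarity solution
    at [x0] with a strictly smaller slope. The difference then passes from positive to negative,
    which [sturm_two_point] forbids. *)
Lemma height_le_profile (P Px Pxx : R -> R -> R) (x0 T a : R) : potential P Px Pxx ->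
  (forall x t, 0 < t -> 0 <= P x t) -> 0 < T -> 0 < a ->
  P x0 T <= T * S a -> - Px x0 T <= Num.sqrt T * W a.
Proof.
move=> pP P0 T0 a0 PSa; rewrite leNgt; apply/negP => WP.
set s := Num.sqrt T in WP.
have s0 : 0 < s by rewrite sqrtr_gt0.
have Ts : T = s ^+ 2 by rewrite sqr_sqrtr// ltW.
have cW : {for a, continuous (fun z => - W z)}.
  exact: cvgN (is_derive_continuous (profileW prof a0)).
have [|r r0 rP] := @continuous_gt_left _ (fun z => - W z) a (Px x0 T / s) cW.
  by rewrite ltrNr -mulNr ltr_pdivlMr// mulrC.
(* Slightly below [a]: the height still exceeds sqrt T * W b by continuity, while T * S b is
   strictly larger than P x0 T. *)
pose b : R := a - Num.min r a / 2.
have ra0 : 0 < Num.min r a by rewrite lt_min r0.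
have [mr ma] : Num.min r a <= r /\ Num.min r a <= a by rewrite !ge_min !lexx orbT.
have b0 : 0 < b by rewrite /b; lra.
have ba : b < a by rewrite /b; lra.
have Wb : Px x0 T + s * W b < 0.
  have := rP (Num.min r a / 2) _; rewrite -/b ltrNr => /(_ _)/wrap[].
    by apply/andP; split; lra.
  by rewrite -mulNr ltr_pdivlMr//; lra.
pose delta : R := T * S b - P x0 T.
(* This strict gap later absorbs the similarity solution at the initial time [t1] and at the right
   end [e]. *)
have delta0 : 0 < delta.
  by rewrite /delta subr_gt0 (le_lt_trans PSa)// ltr_pM2l// profile_decreasing.
pose c : R := x0 - b * s.
pose D x t : R := P x t + delta - similarity_solution c x t.
have bE : (x0 - c) / s = b by rewrite /c; field; lra.
have cx0 : c < x0 by rewrite /c; nra.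
have D0 : D x0 T = 0.
  by rewrite /D /similarity_solution /profile_ext -/s bE b0 /delta; ring.
pose Dx x t := Px x t + Num.sqrt t * W ((x - c) / Num.sqrt t).
pose Dxx x t := Pxx x t + W1 ((x - c) / Num.sqrt t).
pose Dt x t := atan (Pxx x t) - atan (- W1 ((x - c) / Num.sqrt t)).
have dD (x t : R) : c < x -> 0 < t -> [/\ is_derive x 1 (D ^~ t) (Dx x t),
    is_derive x 1 (Dx ^~ t) (Dxx x t) & is_derive t 1 (D x) (Dt x t)].
  move=> cx t0; have [? ? ?] := pP x t t0.
  have [d1 d2 ?] := similarity_solution_derive cx t0.
  split.
  - by rewrite /Dx -[X in _ + X]opprK; apply: is_derive_eq; rewrite addr0.
  - have : is_derive x 1 (fun y => Num.sqrt t * W ((y - c) / Num.sqrt t))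
        (W1 ((x - c) / Num.sqrt t)).
      rewrite -[W1 _]opprK.
      under eq_fun do rewrite -[_ * _]opprK.
      exact: is_deriveN.
    by move=> ?; exact: is_deriveD.
  - by rewrite /Dt; apply: is_derive_eq; rewrite addr0.
have [dx0 _ _] := dD x0 T cx0 T0.
(* [D] decreases strictly through its zero [x0]: it is positive at x0 - h and negative at x0 + h. *)
have [|k k0 kP] := @is_derive_increasing_at _ (fun x => - D x T) x0 (- Dx x0 T).
  by rewrite oppr_gt0 /Dx -/s bE.
pose h : R := Num.min k (b * s) / 2.
have kb0 : 0 < Num.min k (b * s) by rewrite lt_min k0 mulr_gt0.
have [mk mb] : Num.min k (b * s) <= k /\ Num.min k (b * s) <= b * s.
  by rewrite !ge_min !lexx orbT.
have /kP : 0 < h < k by apply/andP; rewrite /h; split; lra.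
rewrite D0 oppr0 => /andP[]; rewrite oppr_lt0 oppr_gt0 => Dl Dr.
have dT0 : 0 < delta / T by rewrite divr_gt0.
have /cvgrPdist_lt/(_ _ dT0)[M [_ MP]] := profileSy prof.
(* Large enough for T * S z0 <= delta, so that [D] is non-negative at [e] up to time [T]; the
   summand 2 * b keeps x0 + h to the left of [e]. *)
pose z0 : R := `|M| + 2 * b + 1.
have M0 : M < z0 by rewrite /z0; have := ler_norm M; lra.
have nM := normr_ge0 M.
have z00 : 0 < z0 by rewrite /z0; lra.
have Sz0 : T * S z0 <= delta.
  have := MP _ M0; rewrite sub0r normrN => /ltr_normlW/ltW.
  by rewrite ler_pdivlMr// mulrC.
pose e : R := c + s * z0.
pose t1 : R := Num.min T (2 * delta / pi) / 2.
have pi0 := @pi_gt0 R.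
have m0 : 0 < Num.min T (2 * delta / pi) by rewrite lt_min T0 divr_gt0; lra.
have [mT md] : Num.min T (2 * delta / pi) <= T /\
    Num.min T (2 * delta / pi) <= 2 * delta / pi by rewrite !ge_min !lexx orbT.
have t10 : 0 < t1 by rewrite /t1; lra.
have t1T : t1 < T by rewrite /t1; lra.
have t1d : t1 * (pi / 2) <= delta.
  have -> : delta = (2 * delta / pi) * (pi / 2) by field; lra.
  by rewrite ler_wpM2r /t1; lra.
have := @sturm_two_point _ D Dx Dxx Dt c e t1 T t1T.
move=> /(_ _ _ _ _ _ _ _ _ _ (x0 - h) (x0 + h)) H.
have := Dr; rewrite ltNge => /negP; apply; apply: H => {Dr kP}.
- by move=> x t cx t1t; have [] := dD x t cx (lt_trans t10 t1t).
- by move=> x t cx t1t; have [] := dD x t cx (lt_trans t10 t1t).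
- by move=> x t cx t1t; have [] := dD x t cx (lt_trans t10 t1t).
- move=> x t cx t1t; rewrite /Dxx /Dt subr_le0 => ?.
  by apply: le_atan; lra.
- move=> x t cx t1t; rewrite /Dxx /Dt subr_ge0 => ?.
  by apply: le_atan; lra.
- move=> p cp t1p; have p0 : 0 < p.2 by exact: lt_le_trans t1p.
  apply: cvgB; last exact: similarity_solution_continuous.
  by apply: cvgD; [exact: (potential_continuous pP)|exact: cvg_cst].
- move=> x cx; have := P0 x t1 t10.
  have : similarity_solution c x t1 <= t1 * (pi / 2).
    by apply: ler_wpM2l; [exact: ltW|exact: profile_ext_le].
  by rewrite /D; lra.
- move=> t /andP[t1t tT]; have t0 : 0 < t by exact: lt_le_trans t1t.
  have := P0 e t t0.
  suff : similarity_solution c e t <= delta by rewrite /D; lra.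
  have st : 0 < Num.sqrt t by rewrite sqrtr_gt0.
  have ts : Num.sqrt t <= s by rewrite ler_wsqrtr.
  rewrite /similarity_solution.
  have -> : e - c = s * z0 by rewrite /e; ring.
  have z1 : z0 <= s * z0 / Num.sqrt t.
    by rewrite ler_pdivlMr// mulrC ler_pM2r.
  rewrite /profile_ext (lt_le_trans z00 z1).
  have Sz1 : S (s * z0 / Num.sqrt t) <= S z0.
    move: z1; rewrite le_eqVlt => /predU1P[<-//|z1].
    exact/ltW/profile_decreasing.
  have [S0|S0] := leP (S (s * z0 / Num.sqrt t)) 0.
    by apply: le_trans (ltW delta0); rewrite pmulr_rle0.
  by apply: le_trans Sz0; apply: ler_pM => //; exact: ltW.
- move=> t r' /andP[t1t _] r'0; have t0 : 0 < t by exact: lt_trans t1t.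
  have [dP _ _] := pP c t t0.
  have [x cx Dx'] := similarity_solution_left_edge dP t0 r'0.
  by exists x => //; rewrite /D !(addrAC _ delta) ltrD2r.
- by rewrite /h /c; lra.
- by rewrite /h; lra.
- have : (2 * b) * s <= z0 * s by rewrite ler_pM2r// /z0; lra.
  by rewrite /e /h /c; lra.
- exact: Dl.
Qed.
End Profile.

(** * Primitives *)

Section Primitive.
Set Implicit Arguments.
Unset Strict Implicit.
Context {R : realType}.
Notation mu := (@lebesgue_measure R).
Implicit Types (f F : R -> R) (x y s t u : R).

(* Exactly one of the two intervals is non-degenerate when [x != 0]. *)
Definition prim f (x : R) : R :=
  \int[mu]_(s in `[0, x]) f s - \int[mu]_(s in `[x, 0]) f s.

Lemma continuous_itv_integrable f a b : continuous f ->
  mu.-integrable `[a, b] (EFin \o f).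
Proof.
move=> cf; apply: continuous_compact_integrable; first exact: segment_compact.
exact: continuous_subspaceT.
Qed.

Lemma prim0 f : prim f 0 = 0.
Proof. by rewrite /prim subrr. Qed.

(** Integrating from a common left end - N removes the case distinction on the sign of [x]. *)
Lemma primE f (N x : R) : continuous f -> `|x| <= N ->
  prim f x = \int[mu]_(s in `[- N, x]) f s - \int[mu]_(s in `[- N, 0]) f s.
Proof.
move=> cf; rewrite ler_norml => /andP[Nx xN].
have intf a b := @continuous_itv_integrable f a b cf.
have int_oc a b : mu.-integrable `]a, b] (EFin \o f).
  by apply: integrableS (intf a b) => //; apply: subset_itvr; rewrite bnd_simp.
rewrite /prim; have [x0|x0|<-] := ltgtP x 0.
- rewrite (set_itv_ge (b1 := BLeft 0)) ?bnd_simp -?ltNge// Rintegral_set0 sub0r.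
  rewrite -[RHS]opprB Rintegral_itvB ?bnd_simp//; last exact: ltW.
  by rewrite Rintegral_itv_obnd_cbnd.
- rewrite (set_itv_ge (b2 := BRight 0)) ?bnd_simp -?ltNge// Rintegral_set0 subr0.
  rewrite Rintegral_itvB ?bnd_simp//; [|lra|exact: ltW].
  by rewrite Rintegral_itv_obnd_cbnd.
- by rewrite !subrr.
Qed.

Lemma prim_derive f (x : R) : continuous f -> is_derive x 1 (prim f) (f x).
Proof.
move=> cf; have nx := normr_ge0 x.
have := ler_norml x `|x|; rewrite lexx => /esym/andP[x1 x2].
have [|||dF F'] := @continuous_FTC1_closed R f (- (`|x| + 1)) x (x + 1) _ _ _ (cf x).
- by rewrite ltrDl.
- exact: continuous_itv_integrable.
- lra.
have := derivableP dF; rewrite -derive1E F' => {}dF.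
apply: (@near_eq_is_derive _ _ _ (fun y => \int[mu]_(s in `[- (`|x| + 1), y]) f s
  - \int[mu]_(s in `[- (`|x| + 1), 0]) f s)); last first.
  by apply: is_derive_eq; rewrite subr0.
near=> y; rewrite (primE (N := `|x| + 1))//.
have -> : y = x + (y - x) by ring.
rewrite (le_trans (ler_normD _ _))// lerD2l; near: y.
by exists 1 => //= y; rewrite distrC => /ltW.
Unshelve. all: by end_near. Qed.

Lemma primB f (a b : R) : continuous f -> a <= b ->
  prim f b - prim f a = \int[mu]_(s in `[a, b]) f s.
Proof.
move=> cf ab; have [na nb] := (normr_ge0 a, normr_ge0 b).
pose N : R := `|a| + `|b| + 1.
have := ler_norml a `|a|; rewrite lexx => /esym/andP[a1 a2].
have intf := @continuous_itv_integrable f (- N) b cf.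
rewrite !(primE (N := N))// ?/N; [|lra|lra]; rewrite -/N.
rewrite opprB addrA subrK Rintegral_itvB ?bnd_simp//; last by rewrite /N; lra.
rewrite Rintegral_itv_obnd_cbnd//; apply: integrableS intf => //.
by apply: subset_itvr; rewrite bnd_simp /N; lra.
Qed.

Lemma prim_unique f F (x : R) : continuous f ->
  (forall y, is_derive y 1 F (f y)) -> prim f x = F x - F 0.
Proof.
move=> cf dF.
have : prim f x - F x = prim f 0 - F 0.
  apply: (@is_derive_0_is_cst R (fun y => prim f y - F y)) => y.
  by have ? := @prim_derive f y cf; apply: is_derive_eq; rewrite subrr.
by rewrite prim0; lra.
Qed.

(** The time derivative is continuous, hence bounded on the compact rectangle [a, b] x
    [t / 2, t + 1]; the bound serves as a constant dominating function. *)
Lemma derive_under_integral (g gt : R -> R -> R) (a b t : R) : 0 < t ->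
  (forall x s, 0 < s -> is_derive s 1 (g x) (gt x s)) ->
  (forall s, 0 < s -> continuous (g ^~ s)) ->
  (forall p : R * R, 0 < p.2 -> {for p, continuous (fun q => gt q.1 q.2)}) ->
  is_derive t 1 (fun s => \int[mu]_(x in `[a, b]) g x s)
    (\int[mu]_(x in `[a, b]) gt x t).
Proof.
move=> t0 dg cg cgt; pose f s x := g x s.
have f'E s x : 0 < s -> partial1of2 f s x = gt x s.
  by move=> s0; rewrite partial1of2E; have [_] := dg x s s0.
have : compact ((fun p : R * R => gt p.1 p.2) @` (`[a, b] `*` `[t / 2, t + 1])).
  apply: continuous_compact; last by apply: compact_setX; exact: segment_compact.
  apply: continuous_in_subspaceT => p; rewrite inE => -[_] /=.
  by rewrite in_itv/= => /andP[tp _]; apply: cgt; lra.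
move=> /compact_bounded[M [_ MP]].
pose K : R := `|M| + 1.
have gtK x s : `[a, b]%classic x -> t / 2 < s < t + 1 -> `|gt x s| <= K.
  move=> abx /andP[ts st]; apply: (MP K); first by rewrite /K; have := ler_norm M; lra.
  by exists (x, s) => //; split => //=; rewrite in_itv/= !ltW.
have It : `]t / 2, t + 1[%classic t by rewrite /= in_itv/=; apply/andP; split; lra.
have intf s : `]t / 2, t + 1[%classic s -> mu.-integrable `[a, b] (EFin \o f s).
  rewrite /= in_itv/= => /andP[s0 _]; apply: continuous_itv_integrable.
  by apply: cg; lra.
have df s x : `]t / 2, t + 1[%classic s -> `[a, b]%classic x -> derivable (f ^~ x) s 1.
  by rewrite /= in_itv/= => /andP[s0 _] _; have [|] := dg x s; first lra.
have K0 : forall x : R, 0 <= cst K x by move=> x; rewrite /= /K; have := normr_ge0 M; lra.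
have intK : mu.-integrable `[a, b] (EFin \o cst K).
  by apply: continuous_itv_integrable => ?; exact: cvg_cst.
have fK s x : `]t / 2, t + 1[%classic s -> `[a, b]%classic x ->
    `|partial1of2 f s x| <= cst K x.
  rewrite /= in_itv/= => ts abx; rewrite f'E; first exact: gtK.
  by move: ts => /andP[ts _]; lra.
have mab : measurable (`[a, b]%classic : set R) by [].
have d := @derivable_under_integral R _ _ mu f _ mab t _ _ It intf df _ K0 intK fK.
have := derivableP d; rewrite -derive1E.
rewrite (@differentiation_under_integral R _ _ mu f _ mab t _ _ It intf df _ K0 intK fK).
by under eq_Rintegral do rewrite f'E//.
Qed.

(** Boundedness allows integration from 0, even though [f] may have no limit there. It is applied to
    the tangent angle at x = 0. *)
Lemma bounded_primitive (f : R -> R) (M : R) :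
  (forall t, 0 < t -> {for t, continuous f}) -> (forall t, `|f t| <= M) ->
  exists2 J : R -> R, (forall t : R, 0 < t -> is_derive t 1 J (f t)) &
    forall t, 0 < t -> `|J t| <= M * t.
Proof.
move=> cf fM.
have mf : measurable_fun `](0 : R), +oo[ f.
  apply: measurable_realfun.open_continuous_measurable_fun; first exact: interval_open.
  by move=> x; rewrite inE/= in_itv/= andbT; exact: cf.
have intf u : mu.-integrable `]0, u] (EFin \o f).
  apply: measurable_bounded_integrable => //.
  - by rewrite /= lebesgue_measure_itv/=; case: ifP; rewrite ltry.
  - by apply: measurable_funS mf => //; exact: subset_itvl.
  - by exists M; split; [exact: num_real|] => K MK x _; apply: le_trans (ltW MK).
exists (fun t => \int[mu]_(s in `]0, t]) f s) => t t0.
  have [| |dJ J'] := @continuous_FTC1 R f (BRight 0) t (t + 1) _ (intf _) _ (cf _ t0).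
  - by rewrite ltrDl.
  - exact: t0.
  by have := derivableP dJ; rewrite -derive1E J'.
apply: le_trans (le_normr_Rintegral _ (intf t)) _ => //.
apply: (@le_trans _ _ (\int[mu]_(s in `]0, t]) M)).
  apply: le_Rintegral => //.
  - by apply/integrable_norm; exact: intf.
  - apply: measurable_bounded_integrable => //.
    + by rewrite /= lebesgue_measure_itv/=; case: ifP; rewrite ltry.
    + by exists `|M|; split; [exact: num_real|] => K MK x _; exact: ltW.
rewrite Rintegral_cst//= lebesgue_measure_itv/= lte_fin t0 sube0//.
Qed.
End Primitive.

(** * Potentials of Ecker-Huisken solutions *)

Section PotentialOfFlow.
Set Implicit Arguments.
Unset Strict Implicit.
Context {R : realType}.
Implicit Types (x s t : R) (f y : R * R -> R).

(** * Partial derivatives and initial values of the flow *)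

Lemma continuous_pairl t x : (fun z : R => (z, t)) @ x --> (x, t).
Proof.
apply: (@cvg_pair _ _ _ (nbhs x) (nbhs x) (nbhs t)); first exact: cvg_id.
exact: cvg_cst.
Qed.

Lemma continuous_pairr x t : (fun s : R => (x, s)) @ t --> (x, t).
Proof.
apply: (@cvg_pair _ _ _ (nbhs t) (nbhs x) (nbhs t)); last exact: cvg_id.
exact: cvg_cst.
Qed.

Lemma is_derive_dx f x t : derivable f (x, t) (1, 0) ->
  is_derive x 1 (fun z => f (z, t)) (dx f (x, t)).
Proof.
move=> df; have E : (fun h : R => h^-1 *: (f (h *: ((1 : R), (0 : R)) + (x, t)) - f (x, t))) =
    (fun h : R => h^-1 *: (f (h *: (1 : R) + x, t) - f (x, t))).
  apply/funext => h; congr (_ *: (f _ - _)).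
  by transitivity (h *: (1 : R) + x, h *: (0 : R) + t); rewrite // scaler0 add0r.
split; first by rewrite /derivable -E; exact: df.
by rewrite /dx /derive -E.
Qed.

Lemma is_derive_dt f x t : derivable f (x, t) (0, 1) ->
  is_derive t 1 (fun s => f (x, s)) (dt f (x, t)).
Proof.
move=> df; have E : (fun h : R => h^-1 *: (f (h *: ((0 : R), (1 : R)) + (x, t)) - f (x, t))) =
    (fun h : R => h^-1 *: (f (x, h *: (1 : R) + t) - f (x, t))).
  apply/funext => h; congr (_ *: (f _ - _)).
  by transitivity (h *: (0 : R) + x, h *: (1 : R) + t); rewrite // scaler0 add0r.
split; first by rewrite /derivable -E; exact: df.
by rewrite /dt /derive -E.
Qed.

Lemma EckerHuisken_smoothP (y0 : R -> R) y : EckerHuisken y0 y -> forall x t, 0 < t ->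
  [/\ is_derive x 1 (fun z => y (z, t)) (dx y (x, t)),
      is_derive x 1 (fun z => dx y (z, t)) (dx (dx y) (x, t)) &
      is_derive t 1 (fun s => y (x, s)) (dt y (x, t))] /\
  ({for (x, t), continuous (dx y)} /\ {for (x, t), continuous (dt y)}).
Proof.
move=> hy x t t0.
have [_ [dy [/= [cyx [dyx _]] [cyt _]]]] := EH_smooth hy 2.
have p0 : [set p : R * R | 0 < p.2] (x, t) by [].
have [d1 d2] := dy _ p0; have [d3 _] := dyx _ p0.
split; last by split; [exact: cyx|exact: cyt].
by split; [exact: is_derive_dx|exact: is_derive_dx|exact: is_derive_dt].
Qed.

Lemma EckerHuisken_initial_continuous (y0 : R -> R) y : EckerHuisken y0 y -> continuous y0.
Proof.
move=> hy x; have /subspace_continuousP/(_ (x, 0)) := EH_continuous hy.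
rewrite /= lexx => /(_ isT) cy.
have -> : y0 = (fun z => y (z, 0)) by apply/funext => z; rewrite (EH_initial hy).
apply: (cvg_comp (fun z : R => (z, 0 : R)) y) cy => A.
rewrite /within/= => nA.
apply: (@filterS _ (nbhs x) _ _ _ _ (@continuous_pairl 0 x _ nA)) => z /=.
by rewrite lexx; apply.
Qed.

Lemma EckerHuisken_uniform_initial (y0 : R -> R) y (N e : R) : EckerHuisken y0 y -> 0 < e ->
  \forall t \near 0^'+, forall x, `|x| <= N -> `|y (x, t) - y0 x| <= e.
Proof.
move=> hy e0; have /fam_cvgP/(_ _ (@segment_compact _ (- N) N)) := EH_cvg hy.
move=> /(_ [set g : R -> R | forall x, `|x| <= N -> `|g x - y0 x| <= e]); apply.
apply/uniform_nbhs; exists [set p : R * R | ball p.1 e p.2]; split.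
  exact: (@entourage_ball _ _ (PosNum e0)).
move=> g /= gP x xN; have := gP x; rewrite /= in_itv/= -ler_norml => /(_ xN).
by rewrite /ball/= distrC => /ltW.
Qed.

Lemma prim_dist_le (f g : R -> R) (x e : R) : continuous f -> continuous g ->
  (forall s, `|s| <= `|x| -> `|f s - g s| <= e) ->
  `|prim f x - prim g x| <= e * `|x|.
Proof.
move=> cf cg fge.
have dfg s : is_derive s 1 (fun z => prim f z - prim g z) (f s - g s).
  have ? := prim_derive s cf; have ? := prim_derive s cg; exact: is_deriveB.
have [x0|x0|->] := ltgtP x 0; last by rewrite !prim0 subrr normr0 mulr0.
- have [c /andP[xc c0]] := mvt x0 (fun s _ => dfg s).
  rewrite !prim0 subrr sub0r sub0r => /eqP; rewrite eqr_oppLR => /eqP ->.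
  by rewrite normrN normrM normrN ler_wpM2r// fge// ltr0_norm// ltr0_norm//; lra.
- have [c /andP[xc c0]] := mvt x0 (fun s _ => dfg s).
  rewrite !prim0 subrr !subr0 => ->.
  by rewrite normrM ler_wpM2r// fge// gtr0_norm// gtr0_norm//; lra.
Qed.

(** With theta = arctan y_x the flow is y_t = theta_x, so the integral of [y] from 0 to [x] has time
    derivative theta(x, t) - theta(0, t). Adding a time primitive [J] of theta(0, t) gives the
    potential. *)
Lemma EckerHuisken_potential (y0 : R -> R) y : EckerHuisken y0 y ->
  exists2 H, potential H (fun x t => y (x, t)) (fun x t => dx y (x, t)) &
    forall x t, 0 < t -> `|H x t - prim y0 x| <= pi / 2 * t.
Proof.
move=> hy; have reg := EckerHuisken_smoothP hy.
have cy0 := EckerHuisken_initial_continuous hy.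
have cy t : 0 < t -> continuous (fun x => y (x, t)).
  by move=> t0 x; have [[d _ _] _] := reg x t t0; exact: is_derive_continuous d.
have cyt t : 0 < t -> continuous (fun x => dt y (x, t)).
  move=> t0 x; have [_ [_ ct]] := reg x t t0.
  exact: (cvg_comp (fun z : R => (z, t)) (dt y)) (@continuous_pairl t x) ct.
pose theta x t : R := atan (dx y (x, t)).
have dtheta x t : 0 < t -> is_derive x 1 (theta ^~ t) (dt y (x, t)).
  move=> t0; have [[_ d _] _] := reg x t t0.
  apply: (is_derive_comp _ d); rewrite (EH_equation hy)//= mulrC; congr (_ * _).
have ctheta t : 0 < t -> {for t, continuous (theta 0)}.
  move=> t0; have [_ [cx _]] := reg 0 t t0.
  apply: (cvg_comp (fun s : R => dx y (0, s)) atan); last exact: continuous_atan.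
  exact: (cvg_comp (fun s : R => (0 : R, s)) (dx y)) (@continuous_pairr 0 t) cx.
have theta_le t : `|theta 0 t| <= pi / 2.
  by rewrite ler_norml ltW ?atan_gtNpi2//= ltW// atan_ltpi2.
have [J dJ J_le] := bounded_primitive ctheta theta_le.
pose H x t := prim (fun z => y (z, t)) x + J t.
have pH : potential H (fun x t => y (x, t)) (fun x t => dx y (x, t)).
  move=> x t t0; have [[? ? _] _] := reg x t t0; split=> //.
    by have ? := prim_derive x (cy t t0); apply: is_derive_eq; rewrite addr0.
  have di a b := @derive_under_integral R (fun x t => y (x, t))
    (fun x t => dt y (x, t)) a b t t0 _ cy _.
  have {}di a b : is_derive t 1 (fun s => \int[lebesgue_measure]_(x in `[a, b]) y (x, s))
      (\int[lebesgue_measure]_(x in `[a, b]) dt y (x, t)).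
    apply: di => [z s s0|[z s] s0]; first by have [[]] := reg z s s0.
    have [_ [_ c]] := reg z s s0.
    by apply: cvg_trans c; apply: near_eq_cvg; apply: nearW => -[].
  have dp : is_derive t 1 (fun s => prim (fun z => y (z, s)) x)
      (theta x t - theta 0 t).
    have <- := @prim_unique _ (fun z => dt y (z, t)) (theta ^~ t) x (cyt t t0)
      (fun z => dtheta z t t0).
    by apply: is_deriveB; exact: di.
  by have ? := dJ t t0; apply: is_derive_eq; rewrite /theta; ring.
exists H => // x t t0; apply/ler_addgt0Pr => e e0.
pose d : R := e / (`|x| + 1).
have x1 : 0 < `|x| + 1 by rewrite ltr_wpDl.
have d0 : 0 < d by rewrite divr_gt0.
(* The distance is split at a small time [s]: the Lipschitz bound costs pi / 2 * (t - s), [J s] at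
   most pi / 2 * s, and uniform convergence on [- |x|, |x|] at most [e]. *)
near (0 : R)^'+ => s.
have s0 : 0 < s by near: s; exact: nbhs_right_gt.
have st : s < t by near: s; exact: nbhs_right_lt.
have ys : forall z, `|z| <= `|x| -> `|y (z, s) - y0 z| <= d.
  by near: s; exact: EckerHuisken_uniform_initial.
have h1 := prim_dist_le (cy s s0) cy0 ys.
have h2 := J_le s s0.
have := potential_lipschitz x pH s0 t0.
rewrite (gtr0_norm (_ : 0 < t - s)) ?subr_gt0// => h3.
have dx_le : d * `|x| <= e.
  have -> : e = d * (`|x| + 1) by rewrite divfK// gt_eqF.
  by rewrite ler_pM2l//; lra.
have -> : H x t - prim y0 x = (H x t - H x s) +
    (prim (fun z => y (z, s)) x - prim y0 x) + J s by rewrite /H; ring.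
apply: le_trans (ler_normD _ _) _.
have := ler_normD (H x t - H x s) (prim (fun z => y (z, s)) x - prim y0 x).
by rewrite mulrBr in h3; lra.
Unshelve. all: by end_near. Qed.
End PotentialOfFlow.

(** * The slice of the self-similar solution *)

Section SelfSimilarSlice.
Set Implicit Arguments.
Unset Strict Implicit.
Context {R : realType}.
Implicit Types x y z : R.

(** The sum of the two arctangents has zero derivative and equals pi / 4 at p = 1. It describes how
    a slope changes under a reflection and a rotation by pi / 4. *)
Lemma atan_quarterB (p : R) : - 1 < p -> atan ((1 - p) / (1 + p)) = pi / 4 - atan p.
Proof.
move=> p1; pose f q : R := atan ((1 - q) / (1 + q)) + atan q.
have df (q : R) : - 1 < q -> is_derive q 1 f 0.
  move=> q1; have d1 : 1 + q != 0 by rewrite gt_eqF//; lra.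
  have dv : is_derive q 1 (fun q : R => (1 - q) / (1 + q)) (- 2 / (1 + q) ^+ 2).
    have ? : is_derive q 1 (fun q : R => (1 + q)^-1) (- (1 + q) ^- 2 *: 1).
      apply: is_deriveV => //.
      by apply: is_derive_eq; rewrite add0r.
    by apply: is_derive_eq; rewrite /GRing.scale/=; field.
  have ? := is_derive_comp (is_derive1_atan _) dv erefl.
  apply: is_derive_eq; field.
  have := sqr_ge0 q; have : 0 < (1 + q) ^+ 2 by rewrite exprn_gt0//; lra.
  by move=> ? ?; rewrite !gt_eqF//; nra.
have f1 : f 1 = pi / 4 by rewrite /f subrr mul0r atan0 add0r atan1.
suff : f p = f 1 by rewrite f1 /f; lra.
have [p_lt|p_gt|->//] := ltgtP p 1.
  have [|c _] := @mvt _ f (fun=> 0) p 1 p_lt; last by lra.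
  by move=> x /andP[px _]; apply: df; exact: lt_le_trans px.
have [|c _] := @mvt _ f (fun=> 0) 1 p p_gt; last by lra.
by move=> x /andP[px _]; apply: df; lra.
Qed.

(** [U] stands for the slice at time 1 of the flow from |x|, [k] for its potential, [h0] for that of
    |x|, and [r] for cos (pi / 4). Since [U] is even, the rotation takes (x, U x) to (X x, X (-
    x)). *)
Variables (U U1 k h0 W : R -> R) (r : R).
Hypothesis r0 : 0 < r.
Hypothesis r2 : 2 * r ^+ 2 = 1.
Let X x : R := r * (x + U x).
Hypothesis dk : forall x, is_derive x 1 k (U x).
Hypothesis dU : forall x, is_derive x 1 U (U1 x).
Hypothesis dh0 : forall x, is_derive x 1 h0 `|x|.
Hypothesis U_even : forall x, U (- x) = U x.
Hypothesis k_odd : forall x, k (- x) = - k x.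
Hypothesis kU1 : forall x, atan (U1 x) = k x - x * U x / 2.
Variable C : R.
Hypothesis k_h0 : forall x, `|k x - h0 x| <= C.
Hypothesis W_gt0 : forall z, 0 < z -> 0 < W z.
Hypothesis X_gt0 : forall x, 0 < X x.
Hypothesis WX : forall x, W (X x) = X (- x).
Hypothesis X_surj : forall z, 0 < z -> exists x, X x = z.

Let dX x : is_derive x 1 X (r * (1 + U1 x)).
Proof. by have ? := dU x; apply: is_derive_eq. Qed.

Lemma slice_gt_norm x : `|x| < U x.
Proof.
have h y : - y < U y.
  by have := X_gt0 y; rewrite /X pmulr_rgt0//; lra.
have [x0|x0] := ger0P x; last exact: h.
by rewrite -U_even; have := h (- x); rewrite opprK.
Qed.

(** [X x] determines X (- x) through [W], and the two coordinates together determine [x]. *)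
Let X_inj : injective X.
Proof.
move=> x y Xxy; have : X (- x) = X (- y) by rewrite -!WX Xxy.
move: Xxy; rewrite /X !U_even.
have rN : r != 0 by rewrite gt_eqF.
by move=> /(mulfI rN) e1 /(mulfI rN) e2; lra.
Qed.

Let X_ge x : 2 * r * x < X x.
Proof.
have := ler_norm x; have := slice_gt_norm x; rewrite /X => ? ?.
by rewrite mulrAC mulrC ltr_pM2l//; lra.
Qed.

(** A continuous injection of the line is strictly monotone; [X] is not decreasing, because it
    exceeds X 0 at X 0 / (2 * r). *)
Lemma slice_increasing x y : x < y -> X x < X y.
Proof.
have [| |inc|dec] := @itv_continuous_inj_mono _ X `]-oo, +oo[.
- by apply: continuous_subspaceT => z; exact: is_derive_continuous (dX z).
- by move=> a b _ _; exact: X_inj.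
- by apply: inc; rewrite in_itv.
- have X0 := X_gt0 0.
  have p0 : 0 < X 0 / (2 * r) by rewrite divr_gt0// mulr_gt0.
  have := dec (X 0 / (2 * r)) 0; rewrite !in_itv/= => /(_ isT isT p0).
  have := X_ge (X 0 / (2 * r)).
  have -> : 2 * r * (X 0 / (2 * r)) = X 0 by field; rewrite gt_eqF.
  by move=> /lt_trans h /h; rewrite ltxx.
Qed.

Let U1N x : U1 (- x) = - U1 x.
Proof.
have : atan (U1 (- x)) = atan (- U1 x) by rewrite atanN !kU1 U_even k_odd; ring.
by move/(congr1 tan); rewrite !atanK.
Qed.

Let U1_geN1 x : - 1 <= U1 x.
Proof.
rewrite leNgt; apply/negP => U1x.
have [|s s0 sP] := @is_derive_increasing_at _ (fun x => - X x) x (- (r * (1 + U1 x))).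
  by rewrite -mulrN pmulr_rgt0//; lra.
have /sP/andP[_] : 0 < s / 2 < s by apply/andP; split; lra.
by rewrite ltrN2 ltNge ltW// slice_increasing//; lra.
Qed.

(** The derivative of atan U1 is (U - x * U1) / 2, which is positive because |x * U1| <= |x| < U.
    The weak bound on [U1] suffices here; strict monotonicity then sharpens it. *)
Lemma slice_slope_increasing x y : x < y -> U1 x < U1 y.
Proof.
move=> xy; rewrite ltNge; apply/negP => /le_atan; rewrite leNgt => /negP; apply.
rewrite !kU1.
have dV z : is_derive z 1 (fun z => k z - z * U z / 2) ((U z - z * U1 z) / 2).
  have ? := dk z; have ? := dU z; apply: is_derive_eq.
  by rewrite /GRing.scale/=; field.
rewrite -subr_gt0; have [c _ ->] := @mvt _ _ _ x y xy (fun z _ => dV z).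
rewrite mulr_gt0 ?subr_gt0// divr_gt0// subr_gt0.
apply: le_lt_trans (slice_gt_norm c).
apply: le_trans (ler_norm _) _; rewrite normrM ler_piMr//.
by rewrite ler_norml U1_geN1/= -lerN2 -U1N U1_geN1.
Qed.

Lemma slice_slope_bound x : - 1 < U1 x < 1.
Proof.
apply/andP; split.
  by apply: le_lt_trans (slice_slope_increasing (_ : x - 1 < x)) => //; lra.
rewrite -ltrN2 -U1N.
by apply: le_lt_trans (slice_slope_increasing (_ : - x - 1 < - x)) => //; lra.
Qed.

(** The vertical gap between the slice and its asymptote, the diagonal. *)
Let q x := U x - x.
Let q_gt0 x : 0 < q x.
Proof. by rewrite /q; have := slice_gt_norm x; have := ler_norm x; lra. Qed.

Let dq x : is_derive x 1 q (U1 x - 1).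
Proof. by have ? := dU x; apply: is_derive_eq. Qed.

Let q_dec x y : x < y -> q y < q x.
Proof.
move=> xy; rewrite -subr_lt0.
have [c _ ->] := @mvt _ _ _ x y xy (fun z _ => dq z).
by have /andP[_ ?] := slice_slope_bound c; rewrite nmulr_rlt0; lra.
Qed.

Lemma slice_slope_cvg : U1 x @[x --> +oo] --> (1 : R).
Proof.
(* A slope at most 1 - e up to [N] would give q N <= U 0 - e * N = - e, against q > 0. *)
apply/cvgrPdist_lt => e e0; pose N : R := U 0 / e + 1.
have U00 : 0 < U 0 by have := slice_gt_norm 0; rewrite normr0.
have N0 : 0 < N by rewrite /N ltr_wpDl// divr_ge0// ltW.
have U1N' : 1 - e < U1 N.
  rewrite ltNge; apply/negP => U1e.
  have [c /andP[c0 cN]] := @mvt _ _ _ 0 N N0 (fun z _ => dq z).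
  have := slice_slope_increasing cN; have := q_gt0 N.
  rewrite subr0 /q subr0 => qN Uc E.
  have : e * N = U 0 + e by rewrite /N; field; lra.
  have : (U1 c - 1) * N <= - e * N by apply: ler_wpM2r; lra.
  lra.
exists N; split; first exact: num_real.
move=> x Nx /=; have := slice_slope_increasing Nx.
by have /andP[_ ?] := slice_slope_bound x; rewrite gtr0_norm; lra.
Qed.

(** k - h0 is nondecreasing and bounded, so its increments over [x / 2, x] tend to 0. Since [q]
    decreases, such an increment is at least q x * x / 2. *)
Lemma slice_gap_cvg : (fun x => x * q x) @ +oo --> (0 : R).
Proof.
pose G x : R := k x - h0 x.
have dG x : is_derive x 1 G (U x - `|x|).
  by have ? := dk x; have ? := dh0 x; exact: is_deriveB.
have Gnd : nondecreasing_fun G.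
  move=> x y; rewrite le_eqVlt => /predU1P[->//|xy].
  rewrite -subr_ge0; have [c _ ->] := @mvt _ _ _ x y xy (fun z _ => dG z).
  by rewrite mulr_ge0 ?subr_ge0// ltW// slice_gt_norm.
have Gb : has_ubound (range G).
  exists C => _ [x _ <-]; exact: le_trans (ler_norm _) (k_h0 x).
have Gl := nondecreasing_cvgr Gnd Gb.
have half : (fun x : R => x / 2) @ +oo --> +oo.
  by apply: gt0_cvgMly.
have Gl2 : (fun x => G (x / 2)) @ +oo --> sup (range G).
  exact: (cvg_comp (fun x : R => x / 2) G half Gl).
apply: (@squeeze_cvgr _ _ _ _ (fun=> 0) (fun x => 2 * (G x - G (x / 2)))).
- near=> x; have x0 : 0 < x by near: x; exact: nbhs_pinfty_gt.
  rewrite mulr_ge0 ?ltW//=.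
  have xx : x / 2 < x by lra.
  have [c /andP[c1 c2] ->] := @mvt _ _ _ (x / 2) x xx (fun z _ => dG z).
  have c0 : 0 < c by lra.
  rewrite gtr0_norm//; have := q_dec c2; rewrite -/(q c).
  move=> qc; have -> : 2 * (q c * (x - x / 2)) = x * q c by field.
  by rewrite ltr_pM2l.
- exact: cvg_cst.
- rewrite -(mulr0 2) -(subrr (sup (range G))).
  by apply: cvgMr; exact: cvgB.
Unshelve. all: by end_near. Qed.


(** A primitive of - X (- x) * X' x, that is, of - W along the curve; the constant pi / 4 makes it
    vanish at +oo. The last term is half the product of the rotated coordinates. *)
Let T x : R := pi / 4 - k x + x * U x / 2 - (U x ^+ 2 - x ^+ 2) / 4.

Let TE x : T x = pi / 4 - atan (U1 x) - (U x ^+ 2 - x ^+ 2) / 4.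
Proof. by rewrite /T kU1; ring. Qed.

Let dT x : is_derive x 1 T (- ((U x - x) * (1 + U1 x) / 2)).
Proof.
have ? := dk x; have ? := dU x; rewrite /T; apply: is_derive_eq.
by rewrite /GRing.scale/=; field.
Qed.

Let square_gap_cvg : (fun x => U x ^+ 2 - x ^+ 2) @ +oo --> (0 : R).
Proof.
have U00 : 0 < U 0 by have := slice_gt_norm 0; rewrite normr0.
apply: (@squeeze_cvgr _ _ _ _ (fun=> 0) (fun x => (U 0 + 2) * (x * q x))).
- near=> x; have x1 : 1 < x by near: x; exact: nbhs_pinfty_gt.
  have x0 : 0 < x by lra.
  have := q_gt0 x; have := q_dec x0; rewrite {2}/q subr0 => q0 qx.
  have -> : U x ^+ 2 - x ^+ 2 = q x * q x + 2 * (x * q x) by rewrite /q; ring.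
  have xq : 0 < x * q x by rewrite mulr_gt0.
  have h1 : q x * q x <= U 0 * q x by apply: ler_wpM2r; exact: ltW.
  have h2 : U 0 * q x <= U 0 * (x * q x).
    by rewrite ler_pM2l// ler_peMl ?(ltW qx)// ltW.
  have h3 : 0 < q x * q x by rewrite mulr_gt0.
  by apply/andP; split; lra.
- exact: cvg_cst.
- have : (fun x => (U 0 + 2) * (x * q x)) @ +oo --> (U 0 + 2) * 0.
    by apply: cvgMr; exact: slice_gap_cvg.
  by rewrite mulr0.
Unshelve. all: by end_near. Qed.

Let atan_U1_cvg : (fun x => atan (U1 x)) @ +oo --> pi / 4.
Proof.
rewrite -atan1; apply: (cvg_comp U1 atan slice_slope_cvg).
exact: continuous_atan.
Qed.

Let T_cvgy : T @ +oo --> (0 : R).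
Proof.
rewrite (_ : T = fun x => pi / 4 - atan (U1 x) - (U x ^+ 2 - x ^+ 2) / 4);
  last by apply/funext => x; exact: TE.
have -> : (0 : R) = pi / 4 - pi / 4 - 0 / 4 by rewrite subrr mul0r subrr.
apply: cvgB; first by apply: cvgB => //; exact: cvg_cst.
by apply: cvgMl.
Qed.

Let T_cvgNy : T @ -oo --> pi / 2.
Proof.
apply/cvgNy_compNP.
rewrite (_ : _ \o _ = fun x => pi / 4 + atan (U1 x) - (U x ^+ 2 - x ^+ 2) / 4);
  last by apply/funext => x; rewrite [LHS]TE U1N atanN opprK U_even sqrrN.
have -> : pi / 2 = pi / 4 + pi / 4 - 0 / 4 :> R by field.
apply: cvgB; first by apply: cvgD => //; exact: cvg_cst.
by apply: cvgMl.
Qed.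

(* [T] is [S] along the parametrization [X] of the abscissa of the rotated graph. *)
Lemma slice_profile : exists W1 S, profile W W1 S.
Proof.
have [g Xg] : {g : R -> R & forall z, 0 < z -> X (g z) = z}.
  apply: (@choice _ _ (fun z x => 0 < z -> X x = z)) => z.
  have [z0|_] := ltP 0 z; last by exists 0.
  by have [x Xx] := X_surj z0; exists x.
have gX : cancel X g by move=> x; apply: X_inj; exact: Xg.
have X_le x y : x <= y -> X x <= X y.
  by rewrite le_eqVlt => /predU1P[->//|/slice_increasing/ltW].
have g_lt z a : 0 < z -> z < X a -> g z < a.
  by move=> z0 za; rewrite ltNge; apply/negP => /X_le; rewrite Xg// leNgt za.
have g_gt z a : X a < z -> a < g z.
  move=> az; have z0 := lt_trans (X_gt0 a) az.
  by rewrite ltNge; apply/negP => /X_le; rewrite Xg// leNgt az.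
have rN : r != 0 by rewrite gt_eqF.
have U1_neq x : 1 + U1 x != 0.
  by have /andP[? _] := slice_slope_bound x; rewrite gt_eqF//; lra.
have dg z : 0 < z -> is_derive z 1 g (r * (1 + U1 (g z)))^-1.
  move=> z0; rewrite -{1}(Xg z z0).
  apply: (@is_derive_inverse _ X); last by rewrite mulf_neq0.
  - by near=> x; exact: gX.
  - by near=> x; exact: is_derive_continuous (dX x).
have WE z : 0 < z -> W z = X (- g z) by move=> z0; rewrite -{1}(Xg z z0) WX.
exists (fun z => - ((1 - U1 (g z)) / (1 + U1 (g z)))), (fun z => T (g z)); split.
- move=> z z0; apply: (is_derive_comp (dT (g z)) (dg z z0)).
  rewrite WE// /X U_even.
  have -> : r * (- g z + U (g z)) = 2 * r ^+ 2 * (r * (U (g z) - g z)) / (2 * r ^+ 2).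
    by field.
  by rewrite {1}r2; field; rewrite rN U1_neq.
- move=> z z0.
  have dNg : is_derive z 1 (fun z => - g z) (- (r * (1 + U1 (g z)))^-1).
    by have ? := dg z z0; exact: is_deriveN.
  have nW : \forall y \near z, X (- g y) = W y.
    by near=> y; rewrite WE//; near: y; exact: lt_nbhsr.
  apply: (near_eq_is_derive nW).
  apply: (@is_derive_comp _ X (fun z => - g z) z _ _ _ (dX (- g z)) dNg).
  by rewrite U1N; field; rewrite rN U1_neq.
- exact: W_gt0.
- move=> z z0; have /andP[? _] := slice_slope_bound (g z).
  (* Adding z * W z / 2 cancels the term (U ^ 2 - x ^ 2) / 4 of [T]; what remains is pi / 4 - atan
     U1, the angle of the rotated curve. *)
  rewrite opprK atan_quarterB// TE WE//.
  have := Xg z z0; move: (g z) => p <-; rewrite /X U_even.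
  have -> : r * (p + U p) * (r * (- p + U p)) / 2 =
    2 * r ^+ 2 * ((U p ^+ 2 - p ^+ 2) / 4) by field.
  by rewrite r2; ring.
- apply: (cvg_comp g T _ T_cvgNy); apply/cvgrNyPlt => A.
  near=> z; apply: g_lt; first by near: z; exact: nbhs_right_gt.
  by near: z; apply: nbhs_right_lt; exact: X_gt0.
- apply: (cvg_comp g T _ T_cvgy); apply/cvgryPgt => A.
  near=> z; apply: g_gt; near: z.
  by apply: nbhs_pinfty_gt; exact: num_real.
- apply/cvgryPgt => A; near=> z.
  have z0 : 0 < z by near: z; exact: nbhs_right_gt.
  have gz : g z < - (A / (2 * r)).
    by apply: g_lt => //; near: z; apply: nbhs_right_lt; exact: X_gt0.
  rewrite WE//; apply: le_lt_trans (X_ge _).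
  have -> : A = 2 * r * (A / (2 * r)) by field.
  by rewrite ler_pM2l ?mulr_gt0//; lra.
Unshelve. all: by end_near. Qed.
End SelfSimilarSlice.

(** * The bound *)

Section SpikeBound.
Set Implicit Arguments.
Unset Strict Implicit.
Context {R : realType}.
Implicit Types x y z t : R.

(** Uniqueness, applied to the reflected and the rescaled potential, makes [K] odd and self-similar,
    because the potential of |x| is so. The remaining hypotheses of [slice_profile] come from
    reading the rotated graph pointwise. *)
Lemma is_W_profile (W : R -> R) : is_W W -> exists W1 S, profile W W1 S.
Proof.
move=> [u [hu W_gt0 imW]].
have [K pK K0] := EckerHuisken_potential hu.
pose h0 := prim (fun x : R => `|x|).
have cn : continuous (fun x : R => `|x|) by exact: norm_continuous.
have dh0 x : is_derive x 1 h0 `|x| by exact: prim_derive.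
have h0_scale l x : 0 < l -> l ^- 2 * h0 (l * x) = h0 x.
  move=> l0; rewrite [RHS](@prim_unique _ _ (fun x => l ^- 2 * h0 (l * x)))//.
    by rewrite mulr0 /h0 prim0 mulr0 subr0.
  move=> z; have dl : is_derive z 1 (fun z => l * z) l.
    by apply: is_derive_eq; rewrite /GRing.scale/= mulr1.
  have ? := @is_derive_comp _ h0 (fun z => l * z) z _ _ _ (dh0 (l * z)) dl erefl.
  apply: is_derive_eq; rewrite /GRing.scale/= normrM (gtr0_norm l0).
  by field; rewrite gt_eqF.
have h0_odd x : - h0 (- x) = h0 x.
  rewrite [RHS](@prim_unique _ _ (fun x => - h0 (- x)))//.
    by rewrite oppr0 /h0 prim0 oppr0 subr0.
  move=> z; have dl : is_derive z 1 (fun z => - z) (- 1) := is_deriveNid _ _.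
  have ? := @is_derive_comp _ h0 (fun z => - z) z _ _ _ (dh0 (- z)) dl erefl.
  by apply: is_derive_eq; rewrite normrN; ring.
have K_odd x t : 0 < t -> - K (- x) t = K x t.
  move=> t0; apply: (potential_unique (potentialN (potential_reflect pK)) pK
    (h0 := h0) (C := pi / 2)) => // {x t t0} x t t0.
  by rewrite -h0_odd -opprD normrN; exact: K0.
have K_scale x t : 0 < t -> K x t = t * K (x / Num.sqrt t) 1.
  move=> t0; pose l := (Num.sqrt t)^-1.
  have l0 : 0 < l by rewrite invr_gt0 sqrtr_gt0.
  have l2 : l ^- 2 = t by rewrite /l exprVn invrK sqr_sqrtr// ltW.
  rewrite (potential_unique pK (potential_scale l0 pK)
    (h0 := h0) (C := pi / 2) K0)//.
    rewrite l2 [l * x]mulrC; congr (_ * K _ _).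
    by rewrite -[X in _ * X]l2 divff// gt_eqF// exprn_gt0.
  move=> w s s0; rewrite -(h0_scale l w l0) -mulrBr normrM.
  rewrite gtr0_norm ?invr_gt0 ?exprn_gt0// mulrC ler_pdivrMr ?exprn_gt0//.
  have -> : pi / 2 * s * l ^+ 2 = pi / 2 * (l ^+ 2 * s) by ring.
  by apply: K0; rewrite mulr_gt0// exprn_gt0.
have dU x : is_derive x 1 (fun z => u (z, 1)) (dx u (x, 1)).
  by have [] := pK x 1 ltr01.
have dk x : is_derive x 1 (K ^~ 1) (u (x, 1)) by have [] := pK x 1 ltr01.
have U_even x : u (- x, 1) = u (x, 1).
  have d1 := dk (- x).
  have d2 : is_derive x 1 (fun z => - K (- z) 1) (u (- x, 1)).
    have ? := @is_derive_comp _ (K ^~ 1) -%R x _ _ _ d1 (is_deriveNid _ _) erefl.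
    by apply: is_derive_eq; rewrite mulrN1 opprK.
  have E : (fun z => - K (- z) 1) = K ^~ 1 by apply/funext => z; rewrite K_odd.
  rewrite E in d2.
  by rewrite -(@derive_val _ _ _ _ _ _ _ d2) -(@derive_val _ _ _ _ _ _ _ (dk x)).
(* Both sides of [K_scale] are differentiated in [t] at t = 1. *)
have kU1 x : atan (dx u (x, 1)) = K x 1 - x * u (x, 1) / 2.
  have [_ _ d1] := pK x 1 ltr01.
  have d2 : is_derive (1 : R) 1 (fun t => t * K (x / Num.sqrt t) 1)
      (K x 1 - x * u (x, 1) / 2).
    have ds : is_derive (1 : R) 1 (fun t : R => x / Num.sqrt t) (- x / 2).
      have := is_derive1_sqrt (ltr01 : 0 < 1 :> R) => ds.
      have ? : is_derive (1 : R) 1 (fun t : R => (Num.sqrt t)^-1)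
          (- Num.sqrt 1 ^- 2 *: (2 * Num.sqrt 1)^-1).
        by apply: is_deriveV; rewrite sqrtr1 oner_neq0.
      by apply: is_derive_eq; rewrite /GRing.scale/= sqrtr1; field.
    have dk' : is_derive (x / Num.sqrt 1) 1 (K ^~ 1) (u (x, 1)).
      by rewrite sqrtr1 divr1.
    have ? := @is_derive_comp _ (K ^~ 1) (fun t => x / Num.sqrt t) 1 _ _ _ dk' ds erefl.
    by apply: is_derive_eq; rewrite /GRing.scale/= sqrtr1 divr1; field.
  have nE : \forall t \near (1 : R), t * K (x / Num.sqrt t) 1 = K x t.
    by near=> t; rewrite -K_scale//; near: t; exact: lt_nbhsr.
  have {}d2 := near_eq_is_derive nE d2.
  by rewrite -(@derive_val _ _ _ _ _ _ _ d1) -(@derive_val _ _ _ _ _ _ _ d2).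
pose r : R := cos (pi / 4).
have pi0 := @pi_gt0 R.
have sr : sin (pi / 4) = r.
  by rewrite -cosBpihalf -cosN /r; congr cos; field.
have r0 : 0 < r by apply: cos_gt0_pihalf; apply/andP; split; lra.
have r2 : 2 * r ^+ 2 = 1.
  by have := cos2Dsin2 (pi / 4 : R); rewrite sr -/r; lra.
have graphW x : 0 < r * (x + u (x, 1)) /\
    W (r * (x + u (x, 1))) = r * (- x + u (- x, 1)).
  have : (graph_on [set x | 0 < x] W) (clockwise (pi / 4) (x, u (x, 1))).
    by rewrite -imW; exists (x, u (x, 1)) => //; exists x.
  move=> [z /= z0]; rewrite /clockwise/= sr -/r => -[zE WzE].
  have -> : r * (x + u (x, 1)) = z by rewrite zE; ring.
  by split=> //; rewrite WzE U_even; ring.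
apply: (@slice_profile R (fun x => u (x, 1)) (fun x => dx u (x, 1)) (K ^~ 1) h0 W r
  r0 r2 dk dU dh0 U_even _ kU1 (pi / 2)) => //.
- by move=> x; rewrite -(K_odd x 1 ltr01) opprK.
- by move=> x; have := K0 x 1 ltr01; rewrite mulr1.
- by move=> x; have [] := graphW x.
- by move=> x; have [] := graphW x.
- move=> z z0; have : (graph_on [set x | 0 < x] W) (z, W z) by exists z.
  rewrite -imW => -[_ [x _ <-]]; rewrite /clockwise/= sr -/r => -[zE _].
  by exists x; rewrite -zE; ring.
Unshelve. all: by end_near. Qed.

(** * The inverse of [sigma] and the total area *)

Variables (W W1 S : R -> R).
Hypothesis prof : profile W W1 S.

Lemma sigma_profile z : 0 < z -> sigma W z = S z.
Proof.
move=> z0.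
have cW x : z <= x -> {for x, continuous W}.
  by move=> zx; exact: is_derive_continuous (profileW prof (lt_le_trans z0 zx)).
have dS x : z <= x -> is_derive x 1 (fun x => - S x) (W x).
  move=> zx; have ? := profileS prof (lt_le_trans z0 zx).
  by apply: is_derive_eq; rewrite opprK.
rewrite /sigma /Rintegral integral_itv_obnd_cbnd; last first.
  apply/measurable_realfun.measurable_EFinP.
  apply: measurable_realfun.open_continuous_measurable_fun.
    exact: interval_open.
  by move=> x; rewrite inE/= in_itv/= andbT => /ltW; exact: cW.
rewrite (@ge0_continuous_FTC2y R W (fun x => - S x) z 0).
- by rewrite EFinN oppeK add0e.
- by move=> x zx; rewrite ltW// (profile_gt0 prof)//; exact: lt_le_trans zx.
- by apply: continuous_in_subspaceT => x; rewrite inE/= in_itv/= andbT; exact: cW.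
- by rewrite -oppr0; apply: cvgN; exact: (profileSy prof).
- by move=> x /ltW/dS[].
- apply: cvg_at_right_filter; exact: is_derive_continuous (dS z (lexx z)).
- move=> x; rewrite in_itv/= andbT => /ltW/dS[_ <-].
  by rewrite derive1E.
Qed.

(** [S] is continuous and strictly decreasing with limits pi / 2 and 0, so [v] is attained, and by
    injectivity the partial inverse returns the point where it is. *)
Lemma sigma_inv_profile v : 0 < v < pi / 2 ->
  0 < sigma_inv W v /\ S (sigma_inv W v) = v.
Proof.
move=> /andP[v0 vpi].
suff [z z0 Sz] : exists2 z, 0 < z & S z = v.
  have -> : sigma_inv W v = z; last by [].
  rewrite /sigma_inv -Sz -sigma_profile// pinvKV ?inE//.
  move=> a b; rewrite !inE/= => a0 b0; rewrite !sigma_profile// => Sab.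
  have [ab|ba|//] := ltgtP a b.
    by have := profile_decreasing prof a0 ab; rewrite Sab ltxx.
  by have := profile_decreasing prof b0 ba; rewrite Sab ltxx.
near (0 : R)^'+ => a.
have a0 : 0 < a by near: a; exact: nbhs_right_gt.
have Sa : v < S a by near: a; exact: (cvgr_gt _ (profileS0 prof)).
near (+oo%R : set_system R) => b.
have ab : a < b by near: b; apply: nbhs_pinfty_gt; exact: num_real.
have Sb : S b < v by near: b; exact: (cvgr_lt _ (profileSy prof)).
have [||c cab Sc] := @IVT R S a b v (ltW ab).
- apply: derivable_within_continuous => x; rewrite in_itv/= => /andP[ax _].
  by have [] := profileS prof (lt_le_trans a0 ax).
- by rewrite ge_min le_max (ltW Sb) (ltW Sa) orbT.
exists c => //; move: cab; rewrite in_itv/= => /andP[+ _]; exact: lt_le_trans.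
Unshelve. all: by end_near. Qed.

Lemma prim_osc_le (f : R -> R) (A0 : R) : continuous f -> (forall x, 0 <= f x) ->
  ('N[lebesgue_measure]_1[EFin \o f] = A0%:E)%E ->
  forall a b, prim f b - prim f a <= A0.
Proof.
move=> cf f0 fA a b.
have A0_ge0 : 0 <= A0 by rewrite -lee_fin -fA Lnorm_ge0.
have [ab|ba] := leP a b.
  rewrite primB// -lee_fin -fA Lnorm1 /Rintegral fineK; last first.
    exact/integrable_fin_num/continuous_itv_integrable.
  rewrite (@eq_integral _ _ _ lebesgue_measure setT (EFin \o f)); last first.
    by move=> x _ /=; rewrite ger0_norm.
  apply: ge0_subset_integral => //=.
  - apply/measurable_realfun.measurable_EFinP.
    exact: measurable_realfun.continuous_measurable_fun.
  - by move=> x _; rewrite lee_fin.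
apply: le_trans A0_ge0; rewrite -opprB oppr_le0 primB//; last exact: ltW.
by apply: Rintegral_ge0 => x _.
Qed.

End SpikeBound.

Theorem theorem1p5 (R : realType) (W : R -> R) (hW : is_W W)
    (y0 : R -> R) (y0_ge0 : forall x, 0 <= y0 x)
    (y0_lip : [locally [lipschitz y0 x | x in setT]])
    (A0 : R) (A0_gt0 : 0 < A0)
    (A0E : ('N[lebesgue_measure]_1[EFin \o y0] = A0%:E)%E)
    (y : R * R -> R) (hy : EckerHuisken y0 y) (t : R) (ht : A0 / pi < t) (x : R) :
  y (x, t) <= Num.sqrt t * W (sigma_inv W (A0 / (2 * t))).
Proof.
have [W1 [S prof]] := is_W_profile hW.
have pi0 := @pi_gt0 R.
have t0 : 0 < t by apply: lt_trans ht; rewrite divr_gt0.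
have [a0 Sa] : 0 < sigma_inv W (A0 / (2 * t)) /\
    S (sigma_inv W (A0 / (2 * t))) = A0 / (2 * t).
  (* The condition t > A0 / pi says exactly that A0 / (2 * t) < pi / 2, the range of [S]. *)
  apply: (sigma_inv_profile prof); rewrite divr_gt0 ?mulr_gt0//=.
  rewrite ltr_pdivrMr ?mulr_gt0//.
  by move: ht; rewrite ltr_pdivrMr// => ht; rewrite mulrA divfK//; lra.
set a := sigma_inv _ _ in a0 Sa *.
have tSa : t * S a = A0 / 2 by rewrite Sa; field; rewrite gt_eqF.
have [H pH H0] := EckerHuisken_potential hy.
have osc := prim_osc_le (EckerHuisken_initial_continuous hy) y0_ge0 A0E.
(* The limit of the primitive at +oo: initially s - prim y0 z is the area to the right of [z], and
   A0 - s + prim y0 z the area to the left. Comparison with constants keeps both non-negative along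
   the flow. *)
pose s := sup (range (prim y0)).
have y0_le_s z : prim y0 z <= s.
  apply: ub_le_sup; last by exists z.
  by exists (prim y0 0 + A0) => _ [w _ <-]; have := osc 0 w; lra.
have s_le z : s <= prim y0 z + A0.
  apply: ge_sup; first by exists (prim y0 0), 0.
  by move=> _ [w _ <-]; have := osc z w; lra.
have right_ge0 z r : 0 < r -> 0 <= s + - H z r.
  move=> r0; rewrite subr_ge0; apply: (potential_le pH (C := pi / 2)) r0 => w r' r'0.
  by have := H0 w r' r'0; rewrite ler_norml => /andP[_ ?]; have := y0_le_s w; lra.
have left_ge0 z r : 0 < r -> 0 <= A0 - s + H (- z) r.
  move=> r0; rewrite -[H _ _]opprK subr_ge0.
  apply: (potential_le (potentialN pH) (C := pi / 2)) r0 => w r' r'0.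
  by have := H0 w r' r'0; rewrite ler_norml => /andP[? _]; have := s_le w; lra.
(* The two areas add up to A0, so one of them is at most A0 / 2; the left one is treated after the
   reflection x -> - x. *)
have [right_le|left_le] := leP (s + - H x t) (A0 / 2).
  rewrite -[y (x, t)]opprK.
  apply: (height_le_profile prof (potentialDl s (potentialN pH)) right_ge0 t0 a0).
  by rewrite tSa.
rewrite -[y (x, t)]opprK -[x]opprK.
apply: (height_le_profile prof (potentialDl (A0 - s) (potential_reflect pH)) left_ge0 t0 a0).
by rewrite tSa opprK; lra.
Qed.
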